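(* Let a nondegenerate tetrahedron in $\mathbb{R}^3$ have Dehn invariant zero, and suppose that the $\mathbb{Q}$-span in $\mathbb{R}/\mathbb{Q}\pi$ of (the classes of) its six dihedral angles has dimension $5$ over $\mathbb{Q}$. Then the tetrahedron is similar to a tetrahedron all of whose six edge lengths are integers, each at most $3.946\times 10^{12}$.
   Context: Label the vertices of a tetrahedron $1,2,3,4$; let $e_{ij}$ be the length of edge $ij$ and $\alpha_{ij}\in(0,\pi)$ the (interior) dihedral angle along edge $ij$. The Dehn invariant is $\mathcal{D}=\sum_{1\le i<j\le 4} e_{ij}\otimes \alpha_{ij}\in \mathbb{R}\otimes_{\mathbb{Q}}(\mathbb{R}/\mathbb{Q}\pi)$, where $\mathbb{Q}\pi=\{q\pi: q\in\mathbb{Q}\}$ and $\mathbb{R}/\mathbb{Q}\pi$ is regarded as a $\mathbb{Q}$-vector space. *)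

(* Defs.v *)
From HB Require Import structures.
From mathcomp.multinomials Require Import freeg.
From mathcomp Require Import all_boot all_order all_algebra perm.
From mathcomp Require Import all_classical all_reals all_analysis.

Set Implicit Arguments.
Unset Strict Implicit.
Unset Printing Implicit Defensive.

Import Order.TTheory GRing.Theory Num.Theory.

Local Open Scope classical_set_scope.
Local Open Scope ring_scope.
Local Open Scope quotient_scope.

Section Span.
Variables (K : fieldType) (V : lmodType K).

Definition lspan (S : set V) : {pred V} :=
  fun x => `[< exists s : seq (K * V),
    (forall p, p \in s -> S p.2) /\ x = \sum_(p <- s) p.1 *: p.2 >].

Fact lspan_submod_closed (S : set V) : submod_closed (lspan S).
Proof.
split; first by apply/asboolP; exists [::]; split=> //; rewrite big_nil.
move=> a x y /asboolP[s [sS ->]] /asboolP[t [tS ->]]; apply/asboolP.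
exists ([seq (a * p.1, p.2) | p <- s] ++ t); split.
  by move=> p; rewrite mem_cat => /orP[/mapP[q qs ->]|/tS//]; apply: sS qs.
rewrite big_cat big_map /= scaler_sumr; congr (_ + _).
by apply: eq_bigr => p _; rewrite scalerA.
Qed.

HB.instance Definition _ (S : set V) :=
  GRing.isSubmodClosed.Build K V (lspan S) (lspan_submod_closed S).

Definition lin_indep (n : nat) (b : n.-tuple V) : Prop :=
  forall c : 'I_n -> K, \sum_(i < n) c i *: tnth b i = 0 -> forall i, c i = 0.

Definition has_dim (W : {pred V}) (n : nat) : Prop :=
  exists b : n.-tuple V, lin_indep b /\ W =i lspan [set` b].

End Span.

Section QuotientModule.
Variables (K : fieldType) (V : lmodType K) (W : submodClosed V).

(* A [submodClosed] predicate over a ring is not inferred to be [zmodClosed],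
   hence this alias. *)
Definition subgroup_of : {pred V} := W.

Fact subgroup_of_closed : zmod_closed subgroup_of.
Proof.
split; first exact: (rpred0 W).
by move=> x y xW yW; rewrite -scaleN1r; apply: (rpredD xW (rpredZ _ yW)).
Qed.

HB.instance Definition _ :=
  GRing.isZmodClosed.Build V subgroup_of subgroup_of_closed.

Definition lquot : Type := Quotient.quot subgroup_of.

HB.instance Definition _ := GRing.Zmodule.on lquot.

Definition lproj (x : V) : lquot := \pi_(Quotient.quot subgroup_of) x.

Definition lquot_scale (a : K) (x : lquot) : lquot :=
  lproj (a *: repr (x : Quotient.quot subgroup_of)).

Fact lproj_eq (x y : V) : (lproj x = lproj y) <-> (x - y \in W).
Proof.
rewrite -[x - y \in W]/(x - y \in subgroup_of) Quotient.idealrBE.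
by split=> /eqP.
Qed.

Fact lproj_repr (x : lquot) : lproj (repr (x : Quotient.quot subgroup_of)) = x.
Proof. exact: reprK. Qed.

Fact lprojD (x y : V) : lproj (x + y) = lproj x + lproj y.
Proof. exact: (@pi_addr _ _ _ _ _ (Quotient.quot subgroup_of)). Qed.

Fact lprojZ (a : K) (x : V) : lproj (a *: x) = lquot_scale a (lproj x).
Proof.
apply/lproj_eq; rewrite -scalerBr rpredZ //.
by apply/lproj_eq; rewrite lproj_repr.
Qed.

Fact lquot_scaleA a b x :
  lquot_scale a (lquot_scale b x) = lquot_scale (a * b) x.
Proof. by rewrite -(lproj_repr x) -!lprojZ scalerA. Qed.

Fact lquot_scale1 : left_id 1 lquot_scale.
Proof. by move=> x; rewrite -(lproj_repr x) -lprojZ scale1r. Qed.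

Fact lquot_scaleDr : right_distributive lquot_scale +%R.
Proof.
move=> a x y; rewrite -(lproj_repr x) -(lproj_repr y).
by rewrite -lprojD -!lprojZ scalerDr lprojD.
Qed.

Fact lquot_scaleDl x : {morph lquot_scale^~ x : a b / a + b}.
Proof.
by move=> a b; rewrite -(lproj_repr x) -!lprojZ scalerDl lprojD.
Qed.

HB.instance Definition _ := GRing.Zmodule_isLmodule.Build K lquot
  lquot_scaleA lquot_scale1 lquot_scaleDr lquot_scaleDl.

End QuotientModule.

Section Tensor.
Variables (K : fieldType) (U V : lmodType K).

Definition free_on : lmodType K := {freeg (U * V) / K}.

Definition gen (u : U) (v : V) : free_on := << (u, v) >>.

Definition bilinear_relations : set free_on :=
  [set x | exists (a : K) (u u' : U) (v : V),
             x = gen (a *: u + u') v - (a *: gen u v + gen u' v)] `|`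
  [set x | exists (a : K) (u : U) (v v' : V),
             x = gen u (a *: v + v') - (a *: gen u v + gen u v')].

Definition tensor : lmodType K := lquot (lspan bilinear_relations).

Definition tens (u : U) (v : V) : tensor :=
  lproj (lspan bilinear_relations) (gen u v).

End Tensor.

Section RealsModQpi.
Variable R : realType.

(* An alias, so that the rat-module structure does not interfere with R. *)
Definition ratvec : Type := R.

HB.instance Definition _ := GRing.Zmodule.on ratvec.

Definition ratvec_scale (q : rat) (x : ratvec) : ratvec := ratr q * (x : R).

Fact ratvec_scaleA a b x :
  ratvec_scale a (ratvec_scale b x) = ratvec_scale (a * b) x.
Proof. by rewrite /ratvec_scale rmorphM mulrA. Qed.

Fact ratvec_scale1 : left_id 1 ratvec_scale.
Proof. by move=> x; rewrite /ratvec_scale rmorph1 mul1r. Qed.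

Fact ratvec_scaleDr : right_distributive ratvec_scale +%R.
Proof. by move=> a x y; rewrite /ratvec_scale mulrDr. Qed.

Fact ratvec_scaleDl x : {morph ratvec_scale^~ x : a b / a + b}.
Proof. by move=> a b; rewrite /ratvec_scale rmorphD mulrDl. Qed.

HB.instance Definition _ := GRing.Zmodule_isLmodule.Build rat ratvec
  ratvec_scaleA ratvec_scale1 ratvec_scaleDr ratvec_scaleDl.

Definition Qpi : {pred ratvec} :=
  fun x => `[< exists q : rat, x = ratr q * (pi : R) >].

Fact Qpi_submod_closed : submod_closed Qpi.
Proof.
split; first by apply/asboolP; exists 0; rewrite rmorph0 mul0r.
move=> a x y /asboolP[q ->] /asboolP[r ->]; apply/asboolP.
exists (a * q + r); rewrite rmorphD rmorphM mulrDl.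
by rewrite -[a *: _]/(ratr a * (ratr q * (pi : R))) mulrA.
Qed.

HB.instance Definition _ :=
  GRing.isSubmodClosed.Build rat ratvec Qpi Qpi_submod_closed.

Definition angle_class (x : R) : lquot Qpi := lproj Qpi x.

End RealsModQpi.

Section Tetrahedra.
Variable R : realType.
Implicit Types (x y p q : 'rV[R]_3) (v w : 'I_4 -> 'rV[R]_3).

Definition dot x y : R := (x *m y^T) 0 0.

(* The norm that the library puts on matrices is the sup norm. *)
Definition enorm x : R := Num.sqrt (dot x x).

Definition angle p q : R := acos (dot p q / (enorm p * enorm q)).

Definition orth_part (e x : 'rV[R]_3) : 'rV[R]_3 :=
  x - (dot x e / dot e e) *: e.

Definition nondegenerate_tetra v : Prop :=
  row_free (\matrix_(i < 3) (v (lift ord0 i) - v ord0)).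

Definition edge_length v (i j : 'I_4) : R := enorm (v i - v j).

Definition opposite (i j : 'I_4) : seq 'I_4 :=
  [seq k <- enum 'I_4 | (k != i) && (k != j)].

(* For i != j, [opposite i j] lists the two vertices k, l off the edge ij. The
   dihedral angle is the angle between the directions, orthogonal to that edge,
   in which the faces ijk and ijl leave it. *)
Definition dihedral v (i j : 'I_4) : R :=
  let k := nth ord0 (opposite i j) 0 in
  let l := nth ord0 (opposite i j) 1 in
  angle (orth_part (v j - v i) (v k - v i)) (orth_part (v j - v i) (v l - v i)).

Definition dehn_invariant v : tensor (ratvec R) (lquot (@Qpi R)) :=
  \sum_(i < 4) \sum_(j < 4 | (i < j)%N)
    tens (edge_length v i j : ratvec R) (angle_class (dihedral v i j)).

Definition dihedral_classes v : set (lquot (@Qpi R)) :=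
  [set a | exists i j : 'I_4, (i < j)%N /\ a = angle_class (dihedral v i j)].

Definition similar_tetra v w : Prop :=
  exists (c : R) (f : 'rV[R]_3 -> 'rV[R]_3) (s : 'S_4),
    [/\ 0 < c,
        forall x y, enorm (f x - f y) = c * enorm (x - y) &
        forall i, f (v i) = w (s i)].

End Tetrahedra.

(* Main.v *)
Require Import Defs.
From HB Require Import structures.
From mathcomp.multinomials Require Import freeg.
From mathcomp Require Import all_boot all_order all_algebra perm.
From mathcomp Require Import ring lra zify.
From mathcomp Require Import all_classical all_reals all_analysis.

Set Implicit Arguments.
Unset Strict Implicit.
Unset Printing Implicit Defensive.

Import Order.TTheory GRing.Theory Num.Theory.

Local Open Scope ring_scope.

(** Edge lengths determine a tetrahedron up to isometry, so the claim is that
    the six edge lengths are proportional to small positive integers.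

    Rationality. Coordinates in a basis of the span of the six angle classes
    form a 6 x 5 rational matrix A of rank 5. Its left kernel is a line over
    the rationals, and it is the space of all rational relations that hold
    between the dihedral angles modulo rational multiples of pi. Applying the
    coordinate functionals to the second factor of the tensor product turns
    the vanishing of the Dehn invariant into e A = 0 for the vector e of edge
    lengths ([relation_matrix]). Hence e is a multiple of a vector n of
    positive integers that spans the relations, and n can be taken minimal
    ([minimal_edges]).

    Size. Rescale, so that the edge lengths are the entries of n, and let N be
    the largest. Doubled dihedral angles t then have a rational cosine and a
    sine that is a rational multiple of six times the volume, so exp(it) is an
    element of norm 1 of an imaginary quadratic field. Its valuation at a prime
    above p is a homomorphism in t, and it can be read off the denominators,
    with no need for ideals: up to sign it is the exponent f(t) of p in the
    denominator of 2 cos t. Indeed the sum and the product of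
    2 cos(t+u) and 2 cos(t-u) are ab and a^2+b^2-4 for a = 2 cos t and
    b = 2 cos u, which forces max(f(t+u), f(t-u)) = f(t) + f(u)
    ([vden_trace]), and a function with this property is the absolute value of
    an additive one ([max_additive]). So every prime p gives an integral linear
    form r_p on integral combinations of the six doubled angles. If all the
    forms vanish on a combination t, then 2 cos t is an integer and t is a
    rational multiple of pi, and conversely ([valuation_forms]).

    The common kernel of the forms r_p is therefore the line through n. Five of
    them are independent, and their maximal minors form a nonzero integral
    vector M proportional to n, so that n <= |M| entrywise by minimality.
    Moreover the cosine along an edge is an integer divided by the square root
    of H_k H_l, where H_k and H_l are 16 times the squared areas of its two
    faces; these are integers, at most 4 N^4. Thus the entry of r_p at that
    edge is at most v_p(H_k) + v_p(H_l), the sum of the absolute values of the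
    entries of r_p is at most 3 v_p(H) with H the product of the four H_k, and
    N is at most the product of 3 v_p(H) over five distinct primes
    ([bounded_proportional_vector]). Since the product of the p^v_p(H) is at
    most H <= 256 N^16, this bounds N by a constant times the fifth power of
    log N, which fails beyond the stated bound ([logarithmic_bound]). *)

(** * Linear functionals on the tensor product *)

Section LinearAlgebra.
Variable (K : fieldType).

Local Open Scope classical_set_scope.

Lemma lspanP (V : lmodType K) n (b : n.-tuple V) (x : V) :
  x \in lspan [set` b] ->
  exists c : 'rV[K]_n, x = \sum_(i < n) c 0 i *: tnth b i.
Proof.
move=> /asboolP[s [sb ->]]; elim: s sb => [|p s IHs] sb.
  by exists 0; rewrite big_nil big1 // => i _; rewrite mxE scale0r.
have [|c ec] := IHs; first by move=> q qs; apply: sb; rewrite in_cons qs orbT.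
have /= /tnthP[j ej] := sb p (mem_head _ _).
exists (c + p.1 *: delta_mx 0 j); rewrite big_cons ec ej.
under [RHS]eq_bigr do rewrite !mxE scalerDl /=.
rewrite big_split /= addrC; congr (_ + _).
rewrite (bigD1 j) //= !eqxx mulr1 big1 ?addr0 // => i /negPf->.
by rewrite mulr0 scale0r.
Qed.

(** Zorn's lemma: among the subspaces that meet the span of [b] trivially, a
    maximal one is a complement. *)
Lemma complement_exists (V : lmodType K) n (b : n.-tuple V) : lin_indep b ->
  exists A : set V,
    [/\ forall k x y, A x -> A y -> A (k *: x + y),
        forall c : 'rV[K]_n, A (\sum_(i < n) c 0 i *: tnth b i) -> c = 0 &
        forall v, exists c : 'rV[K]_n, A (v - \sum_(i < n) c 0 i *: tnth b i)].
Proof.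
move=> bfree; pose comb (c : 'rV[K]_n) := \sum_(i < n) c 0 i *: tnth b i.
have combD k c c' : comb (k *: c + c') = k *: comb c + comb c'.
  rewrite /comb scaler_sumr -big_split; apply: eq_bigr => i _.
  by rewrite !mxE scalerDl scalerA.
have comb0 c : comb c = 0 -> c = 0.
  move=> c0; apply/rowP => i; rewrite !mxE.
  exact: (bfree (fun i => c 0 i) c0).
pose P : set (set V) := [set A | [/\ A 0,
  forall k x y, A x -> A y -> A (k *: x + y) &
  forall c, A (comb c) -> c = 0]].
have [|A [[A0 Alin Ab] Amax]] := @Zorn_bigcup V [set A | P (A `|` [set 0])].
  move=> F FP Ftot; split; first by right.
    move=> k x y [[X FX Xx]|x0] [[Y FY Yy]|y0].
    - have [XY|YX] := Ftot _ _ FX FY.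
        have [_ lin _] := FP _ FY.
        have [?|?] := lin k _ _ (or_introl (XY _ Xx)) (or_introl Yy).
          by left; exists Y.
        by right.
      have [_ lin _] := FP _ FX.
      have [?|?] := lin k _ _ (or_introl Xx) (or_introl (YX _ Yy)).
        by left; exists X.
      by right.
    - have [_ lin _] := FP _ FX.
      have [?|?] := lin k _ _ (or_introl Xx) (or_intror y0).
        by left; exists X.
      by right.
    - by left; exists Y => //; rewrite x0 scaler0 add0r.
    - by right; rewrite x0 y0 scaler0 addr0.
  move=> c [[X FX Xc]|/comb0//]; have [_ _] := FP _ FX; apply; by left.
exists (A `|` [set 0]); split => // v; apply: contrapT => nv.
have Alin0 k x : (A `|` [set 0]) x -> (A `|` [set 0]) (k *: x).
  by move=> Ax; rewrite -[k *: x]addr0; apply: Alin.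
pose B : set V := [set x | exists k a, (A `|` [set 0]) a /\ x = k *: v + a].
apply: (Amax B).
  split; first by move=> x Ax; exists 0, x; split; [left|rewrite scale0r add0r].
  move=> /(_ v) Av; apply: nv; exists 0; left.
  rewrite big1 ?subr0; last by move=> i _; rewrite mxE scale0r.
  by apply: Av; exists 1, 0; split => //; rewrite scale1r addr0.
have BE : B `|` [set 0] = B.
  apply/seteqP; split=> [x [//|->]|x Bx]; last by left.
  by exists 0, 0; split=> //; rewrite scale0r addr0.
rewrite /mkset BE; split.
- by rewrite -BE; right.
- move=> k _ _ [c [a [Aa ->]]] [c' [a' [Aa' ->]]].
  exists (k * c + c'), (k *: a + a'); split; first exact: Alin.
  by rewrite scalerDr scalerDl scalerA addrACA.
- move=> c [k [a [Aa ec]]]; have [k0|k0] := eqVneq k 0.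
    by apply: Ab; rewrite ec k0 scale0r add0r.
  case: nv; exists (k^-1 *: c).
  have -> : \sum_(i < n) (k^-1 *: c) 0 i *: tnth b i = comb (k^-1 *: c + 0).
    by rewrite addr0.
  rewrite combD ec scalerDr scalerA mulVf // scale1r.
  have -> : comb 0 = 0 by apply: big1 => i _; rewrite mxE scale0r.
  rewrite addr0 opprD addNKr -scalerN -scaleN1r.
  by apply: (Alin0); apply: (Alin0).
Qed.

Lemma coordinate_map (V : lmodType K) n (b : n.-tuple V) : lin_indep b ->
  exists psi : V -> 'rV[K]_n,
    (forall k x y, psi (k *: x + y) = k *: psi x + psi y) /\
    (forall c : 'rV[K]_n, psi (\sum_(i < n) c 0 i *: tnth b i) = c).
Proof.
move=> /complement_exists[A [Alin Ab /choice[psi psiP]]]; exists psi.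
have uniq v (c : 'rV_n) : A (v - \sum_(i < n) c 0 i *: tnth b i) -> psi v = c.
  move=> Ac; apply/eqP; rewrite -subr_eq0; apply/eqP/Ab.
  have := Alin (-1) _ _ (psiP v) Ac; rewrite scaleN1r opprB addrA subrK.
  rewrite -sumrB; congr A; apply: eq_bigr => i _.
  by rewrite !mxE scalerDl scaleNr.
split=> [k x y|c]; apply: uniq.
  have := Alin k _ _ (psiP x) (psiP y); rewrite scalerBr addrACA; congr A.
  congr (_ + _); rewrite -opprD; congr (- _).
  rewrite scaler_sumr -big_split; apply: eq_bigr => i _.
  by rewrite !mxE scalerDl scalerA.
rewrite subrr.
by have := Alin (-1) _ _ (psiP 0) (psiP 0); rewrite scaleN1r addNr.
Qed.

(** The universal property of the tensor product, by which a vanishing tensor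
    is exploited: a bilinear map kills the defining relations, hence factors
    through the quotient. *)
Lemma tensor_lift (U V M : lmodType K) (g : U -> V -> M) :
    (forall a u u' v, g (a *: u + u') v = a *: g u v + g u' v) ->
    (forall a u v v', g u (a *: v + v') = a *: g u v + g u v') ->
  exists L : tensor U V -> M,
    [/\ L 0 = 0, {morph L : x y / x + y} &
        forall u v, L (tens u v) = g u v].
Proof.
move=> gl gr; pose G := fun p : U * V => g p.1 p.2.
pose lift : free_on U V -> M := fglift G.
have liftB : {morph lift : x y / x - y} by exact: lift_is_additive.
have lift0 : lift 0 = 0 by rewrite -[0]subr0 liftB subrr.
have liftN x : lift (- x) = - lift x by rewrite -sub0r liftB lift0 sub0r.
have liftD : {morph lift : x y / x + y}.
  by move=> x y; rewrite -{1}[y]opprK liftB liftN opprK.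
have lift_sum (I : Type) (s : seq I) F :
    lift (\sum_(i <- s) F i) = \sum_(i <- s) lift (F i) 
  by apply: (big_morph lift liftD lift0).
have liftgen u v : lift (gen u v) = g u v by rewrite /lift liftU scale1r.
have liftZ k : {morph lift : x / k *: x}.
  move=> x; rewrite -[in RHS](freeg_sumE x) [RHS](congr1 _ (lift_sum _ _ _)).
  rewrite -[k *: x]/(fgscale k x) /fgscale lift_sum scaler_sumr.
  by apply: eq_bigr => y _; rewrite /lift !liftU scalerA.
have liftrel x : x \in lspan (@bilinear_relations K U V) -> lift x = 0.
  move=> /asboolP[s [sR ->]]; rewrite lift_sum big_seq big1 // => p /sR.
  rewrite liftZ.
  case=> -[a [u [v [w ->]]]]; rewrite liftB liftD liftZ !liftgen.
    by rewrite gl subrr scaler0.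
  by rewrite gr subrr scaler0.
have lift_eq x y : lproj (lspan (@bilinear_relations K U V)) x =
    lproj (lspan (@bilinear_relations K U V)) y -> lift x = lift y.
  by move=> /lproj_eq/liftrel; rewrite liftB => /eqP; rewrite subr_eq0 => /eqP.
pose rep (x : tensor U V) : free_on U V :=
  repr (x : Quotient.quot (subgroup_of (lspan (@bilinear_relations K U V)))).
have repK x : lproj (lspan (@bilinear_relations K U V)) (rep x) = x.
  exact: lproj_repr.
have LD : {morph (lift \o rep) : x y / x + y}.
  move=> x y; rewrite /= -liftD; apply: lift_eq.
  by rewrite repK lprojD !repK.
exists (lift \o rep); split=> //.
  by apply/(@addrI _ ((lift \o rep) 0)); rewrite -LD !addr0.
move=> u v; rewrite -liftgen /=; apply: lift_eq.
by rewrite repK.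
Qed.

End LinearAlgebra.

(** [A] holds the coordinates of the [a k] in a basis of their span. The basis
    lies in the span of the [a k], so the rows of [A] span the row space. The
    coordinate functionals [psi] are defined on all of [V], so that
    [u, v |-> psi v 0 j *: u] can be applied to a vanishing tensor. *)
Lemma relation_matrix (K : fieldType) (U V : lmodType K) m n
    (a : 'I_m -> V) (S : set V) :
    S = range a -> has_dim (lspan S) n ->
  exists A : 'M[K]_(m, n), [/\ row_full A,
    forall c : 'rV[K]_m, \sum_(k < m) c 0 k *: a k = 0 <-> c *m A = 0 &
    forall u : 'I_m -> U, \sum_(k < m) tens (u k) (a k) = 0 ->
      forall j, \sum_(k < m) A k j *: u k = 0].
Proof.
move=> SE [b [bfree Sb]]; have [psi [psil psib]] := coordinate_map bfree.
pose A := \matrix_(k < m) psi (a k).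
have rowA k : row k A = psi (a k) by rewrite rowK.
have psiD x y : psi (x + y) = psi x + psi y.
  by have := psil 1 x y; rewrite !scale1r.
have psi0 : psi 0 = 0.
  by apply: (@addrI _ (psi 0)); rewrite -psiD !addr0.
have psiZ k x : psi (k *: x) = k *: psi x.
  by have := psil k x 0; rewrite psi0 !addr0.
have psi_sum (I : Type) (s : seq I) (F : I -> V) :
  psi (\sum_(i <- s) F i) = \sum_(i <- s) psi (F i).
  by apply: (big_morph psi psiD psi0).
have inS k : a k \in lspan S.
  apply/asboolP; exists [:: (1, a k)]; split=> [p|].
    by rewrite inE => /eqP->; rewrite SE; exists k.
  by rewrite big_seq1 scale1r.
have bK x : x \in lspan S -> x = \sum_(i < n) psi x 0 i *: tnth b i.
  by rewrite Sb => /lspanP[c ->]; rewrite psib.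
have psiA (c : 'rV_m) : psi (\sum_(k < m) c 0 k *: a k) = c *m A.
  by rewrite mulmx_sum_row psi_sum; apply: eq_bigr => k _; rewrite rowA psiZ.
exists A; split.
- rewrite -sub1mx; apply/row_subP => i.
  have -> : row i 1%:M = psi (tnth b i).
    rewrite -(psib (row i 1%:M)); congr psi; rewrite (bigD1 i) //= big1.
      by rewrite !mxE eqxx scale1r addr0.
    by move=> j ji; rewrite !mxE eq_sym (negPf ji) scale0r.
  have /asboolP[s [sS ->]] : tnth b i \in lspan S.
    rewrite Sb; apply/asboolP; exists [:: (1, tnth b i)]; split=> [p|].
      by rewrite inE => /eqP->; apply: mem_tnth.
    by rewrite big_seq1 scale1r.
  rewrite psi_sum big_seq; apply: summx_sub => p /sS; rewrite SE => -[k _ <-].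
  by rewrite psiZ scalemx_sub // -rowA row_sub.
- move=> c; rewrite -psiA; split=> [->//|c0]; rewrite [LHS]bK ?c0.
    by rewrite big1 // => i _; rewrite mxE scale0r.
  by apply: rpred_sum => k _; apply: rpredZ.
- move=> u u0 j; have [||L [L0 LD Ltens]] :=
      @tensor_lift K U V U (fun x v => psi v 0 j *: x).
  + by move=> k x y v; rewrite scalerDr !scalerA mulrC.
  + by move=> k x v w; rewrite psil !mxE scalerDl scalerA.
  have := congr1 L u0; rewrite L0 (big_morph L LD L0) => Lu0.
  rewrite -{}[RHS]Lu0; apply: eq_bigr => k _.
  by rewrite Ltens -rowA !mxE.
Qed.

Lemma common_denominator m (v : 'I_m -> rat) :
  exists (d : nat) (z : 'I_m -> int),
    (0 < d)%N /\ forall k, v k * d%:R = (z k)%:~R.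
Proof.
exists (\prod_k `|denq (v k)|)%N.
exists (fun k => numq (v k) * (\prod_(j | j != k) `|denq (v j)|)%N%:Z).
split; first by apply: prodn_gt0 => k; rewrite absz_gt0 denq_neq0.
move=> k; rewrite (bigD1 k) //= natrM mulrA intrM -pmulrn.
congr (_ * _); rewrite pmulrn abszE gtr0_norm ?denq_gt0 //.
by rewrite -{1}(divq_num_den (v k)) divfK // intr_eq0 denq_neq0.
Qed.

(** The left kernel of [A] is a rational line, also after extension of scalars
    to the reals. A positive real vector [e] on it is thus a multiple of any
    rational vector spanning it, and clearing denominators and signs gives
    [n]. *)
Lemma positive_kernel_integral (R : realType) m (A : 'M[rat]_(m.+1, m))
    (e : 'I_m.+1 -> R) :
    row_full A -> (forall k, 0 < e k) ->
    (forall j, \sum_k ratr (A k j) * e k = 0) ->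
  exists (n : 'I_m.+1 -> nat) (l : R),
    [/\ 0 < l, forall k, (0 < n k)%N, forall k, e k = l * (n k)%:R &
        forall c : 'rV[rat]_m.+1, c *m A = 0 ->
          forall i j, c 0 i * (n j)%:R = c 0 j * (n i)%:R].
Proof.
move=> fullA e_gt0 eA.
have rk1 : \rank (kermx A) = 1%N.
  by rewrite mxrank_ker; move: fullA => /eqP->; rewrite subSn ?subnn.
have [v vE] : exists v : 'rV[rat]_m.+1, (v :=: kermx A)%MS.
  move: (row_base _) (eq_row_base (kermx A)); rewrite rk1 => v vE.
  by exists v.
pose er : 'rV[R]_m.+1 := \row_k e k.
have [l0 el0] : exists l0 : R, er = l0 *: map_mx ratr v.
  apply/sub_rVP; have : (er <= kermx (map_mx ratr A))%MS.
    apply/sub_kermxP/rowP => j; rewrite !mxE -[RHS](eA j).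
    by apply: eq_bigr => k _; rewrite !mxE mulrC.
  by rewrite -map_kermx => /submx_trans-> //; rewrite map_submx vE.
have ek k : e k = l0 * ratr (v 0 k) by move/rowP/(_ k): el0; rewrite !mxE.
have [d [z [d_gt0 dz]]] := common_denominator (v 0).
have dz' k : `|v 0 k| = `|z k|%N%:R / d%:R.
  have d_neq0 : d%:R != 0 :> rat by rewrite pnatr_eq0 -lt0n.
  apply: (mulIf d_neq0); rewrite divfK //.
  rewrite -[X in `|_| * X]ger0_norm ?ler0n // -normrM dz.
  by rewrite pmulrn abszE intr_norm.
have l0_neq0 : l0 != 0.
  by apply: contraTneq (e_gt0 ord0) => l00; rewrite ek l00 mul0r ltxx.
pose l := `|l0| / d%:R : R; have l_gt0 : 0 < l.
  by rewrite divr_gt0 ?normr_gt0 // ltr0n.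
have en k : e k = l * `|z k|%N%:R.
  rewrite -[LHS]gtr0_norm // ek normrM.
  have -> : `|ratr (v 0 k)| = ratr `|v 0 k| :> R by rewrite ratr_norm.
  by rewrite dz' fmorph_div /= !ratr_nat mulrAC mulrA.
exists (fun k => `|z k|%N), l; split=> //.
- move=> k; rewrite absz_gt0; apply: contraTneq (e_gt0 k) => zk0.
  have /eqP := dz k; rewrite zk0 mulf_eq0 pnatr_eq0 (gtn_eqF d_gt0) orbF.
  by move=> /eqP v0; rewrite ek v0 rmorph0 mulr0 ltxx.
- move=> c /eqP; rewrite -sub_kermx -vE => /sub_rVP[q ->] i j; rewrite !mxE.
  apply: (fmorph_inj (ratr : rat -> R)); rewrite !rmorphM /= !ratr_nat.
  have vn k : ratr (v 0 k) = l / l0 * `|z k|%N%:R.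
    by apply: (mulfI l0_neq0); rewrite -ek en mulrA mulrCA divff ?mulr1.
  by rewrite !vn; ring.
Qed.

(** * Valuations read off denominators *)

(** If [f] is the absolute value of an additive [g] with [g u > 0], then
    [g x = f (k u + x) - k f u] for all large [k]. This formula defines [g]:
    in the functional equation at [k u + x] and [k u + y] the value at the
    difference [x - y] is too small to be the maximum, so the value at the sum
    [2 k u + (x + y)] is the sum of the values. Taking [k] among the powers of 2
    makes the doubling of [k] harmless. *)
Lemma max_additive (V : zmodType) (f : V -> nat) :
    (forall x y, maxn (f (x + y)) (f (x - y)) = (f x + f y)%N) ->
  exists g : V -> int, {morph g : x y / x + y} /\ forall x, f x = `|g x|%N.
Proof.
move=> fmax.
have f0 : f 0 = 0%N by have := fmax 0 0; rewrite addr0 subr0; lia.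
have fN x : f (- x) = f x.
  have := fmax 0 x; have := fmax 0 (- x).
  by rewrite !add0r opprK f0; lia.
have fD x y : (f (x + y)%R <= f x + f y)%N by rewrite -fmax leq_maxl.
have fB x y : (f (x - y)%R <= f x + f y)%N by rewrite -fmax leq_maxr.
have [[u u_gt0]|f00] := pselect (exists u, (0 < f u)%N); last first.
  exists (fun _ => 0); split=> // x; case E: (f x) => [//|k].
  by case: f00; exists x; rewrite E.
have fMn k : f (u *+ k) = (k * f u)%N.
  suff [] : f (u *+ k) = (k * f u)%N /\ f (u *+ k.+1) = (k.+1 * f u)%N by [].
  elim: k => [|k [IH1 IH2]]; first by rewrite mulr0n f0 mulr1n mul1n.
  split=> //; have := fmax (u *+ k.+1) u.
  rewrite -mulrSr [X in f (X - u)]mulrSr addrK IH1 IH2 !mulSn.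
  by move: (f (u *+ k.+2)) (k * f u)%N => c d; lia.
pose G j x : int := (f (u *+ 2 ^ j + x))%:Z - (2 ^ j * f u)%:Z.
have big j : (2 ^ j <= 2 ^ j * f u)%N by rewrite leq_pmulr.
have GD j x y : (f x + f y < 2 ^ j)%N -> G j.+1 (x + y) = G j x + G j y.
  move=> ltj; have := fmax (u *+ 2 ^ j + x) (u *+ 2 ^ j + y).
  have := fB (u *+ 2 ^ j + x) x; have := fB (u *+ 2 ^ j + y) y.
  rewrite /G !addrK addrACA -mulrnDr addnn -mul2n -expnS.
  rewrite opprD addrACA subrr add0r fMn expnS -mulnA.
  have := fB x y; have := big j; move: ltj.
  move: (f (_ + (x + y))) (f (x - y)) (f (_ + x)) (f (_ + y)) (f x) (f y).
  by move: (2 ^ j * f u)%N (2 ^ j)%N => *; lia.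
have G0 j : G j 0 = 0 by rewrite /G addr0 fMn subrr.
have Gstable x i j : (f x < 2 ^ i)%N -> (i <= j)%N -> G j x = G i x.
  move=> ltxi; elim: j => [|j IHj]; first by rewrite leqn0 => /eqP->.
  rewrite leq_eqVlt => /predU1P[->//|ij]; rewrite -IHj // -{1}[x]addr0 GD.
    by rewrite G0 addr0.
  by rewrite f0 addn0 (leq_trans ltxi) // leq_pexp2l.
have lt2 m : (m < 2 ^ m)%N by rewrite ltn_expl.
pose g x := G (f x) x; have gE x j : (f x <= j)%N -> g x = G j x.
  by move=> xj; rewrite (Gstable x (f x)).
have gD : {morph g : x y / x + y}.
  move=> x y; pose j := (f x + f y + f (x + y)%R)%N.
  rewrite (gE x j) ?(gE y j) ?(gE (x + y) j.+1) ?GD //; try by rewrite /j; lia.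
  by apply: leq_trans (lt2 j); rewrite /j; lia.
exists g; split=> // x.
have g0 : g 0 = 0 by rewrite /g G0.
have gN : g (- x) = - g x by apply/eqP; rewrite -addr_eq0 -gD addNr g0.
have := fmax (u *+ 2 ^ f x) x; move: gN; rewrite fMn /g fN /G.
move: (2 ^ _ * f u)%N (f (_ + x)) (f (_ - x)) => c a b.
by move: (f x) => *; lia.
Qed.

Section DenominatorValuation.
Variables (p : nat) (p_pr : prime p).

Definition vden (x : rat) : nat := logn p `|denq x|.

Lemma denq_dvd (x : rat) (n d : int) : x * d%:~R = n%:~R -> (denq x %| d)%Z.
Proof.
move=> xd; have e : numq x * d = n * denq x.
  apply: (@intr_inj rat); rewrite !intrM -xd mulrAC; congr (_ * _).
  by rewrite -{2}(divq_num_den x) divfK // intr_eq0 denq_neq0.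
rewrite -(@Gauss_dvdzr (denq x) (numq x)); first by rewrite e dvdz_mull.
by rewrite coprimezE coprime_sym coprime_num_den.
Qed.

Lemma vden_le (x : rat) (n d : int) :
  d != 0 -> x * d%:~R = n%:~R -> (vden x <= logn p `|d|)%N.
Proof.
by move=> d0 /denq_dvd; rewrite dvdzE => /dvdn_leq_log; apply; rewrite absz_gt0.
Qed.

Lemma vden_int (n : int) : vden n%:~R = 0%N.
Proof. by rewrite /vden denq_int logn1. Qed.

Lemma vdenN x : vden (- x) = vden x.
Proof. by rewrite /vden denqN. Qed.

Lemma vden_leP x k : (vden x <= k)%N <->
  exists n u : int, [/\ u != 0, logn p `|u| = 0%N &
    x * (p%:Z ^+ k * u)%:~R = n%:~R].
Proof.
have p0 : p%:Z != 0 by rewrite eqz_nat -lt0n prime_gt0.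
split=> [xk|[n [u [u0 pu xu]]]]; last first.
  apply: leq_trans (vden_le _ xu) _; first by rewrite mulf_neq0 ?expf_neq0.
  rewrite abszM lognM ?absz_gt0 ?expf_neq0 // pu addn0.
  by rewrite abszX pfactorK.
have := pfactor_dvdnn p `|denq x|; rewrite -/(vden x) => /dvdnP[u eu].
have u_gt0 : (0 < u)%N.
  by have := denq_neq0 x; rewrite -absz_gt0 eu muln_gt0 => /andP[].
exists (numq x * p%:Z ^+ (k - vden x)), u%:Z; split.
- by rewrite eqz_nat -lt0n.
- have : vden x = logn p `|denq x| by [].
  by rewrite eu lognM ?expn_gt0 ?(prime_gt0 p_pr) // pfactorK //=; lia.
- rewrite -{1}(subnK xk) exprD -mulrA.
  have -> : p%:Z ^+ vden x * u%:Z = denq x.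
    by rewrite -[denq x]gez0_abs ?(ltW (denq_gt0 _)) // eu -!natz natrM natrX mulrC.
  rewrite !intrM mulrCA mulrC; congr (_ * _).
  by rewrite -{1}(divq_num_den x) divfK // intr_eq0 denq_neq0.
Qed.

Lemma vdenD x y : (vden (x + y)%R <= maxn (vden x) (vden y))%N.
Proof.
have [n [u [u0 pu xu]]] := (vden_leP x _).1 (leq_maxl (vden x) (vden y)).
have [m [v [v0 pv yv]]] := (vden_leP y _).1 (leq_maxr (vden x) (vden y)).
move: (maxn _ _) xu yv => k xu yv; apply/vden_leP.
exists (n * v + m * u), (u * v); split; first exact: mulf_neq0.
  by rewrite abszM lognM ?absz_gt0 // pu pv.
by rewrite intrD !intrM -xu -yv !intrM; ring.
Qed.

Lemma vdenM_le x y : (vden (x * y)%R <= vden x + vden y)%N.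
Proof.
have [n [u [u0 pu xu]]] := (vden_leP x _).1 (leqnn (vden x)).
have [m [v [v0 pv yv]]] := (vden_leP y _).1 (leqnn (vden y)).
apply/vden_leP; exists (n * m), (u * v); split; first exact: mulf_neq0.
  by rewrite abszM lognM ?absz_gt0 // pu pv.
by rewrite exprD [RHS]intrM -xu -yv !intrM; ring.
Qed.

Lemma vden_num x : (0 < vden x)%N -> logn p `|numq x| = 0%N.
Proof.
rewrite logn_gt0 mem_primes => /and3P[_ _ pd].
rewrite lognE p_pr /=; case: ifP => // /andP[_ pn].
have := coprime_num_den x; rewrite /coprime => /eqP g1.
by move: (dvdn_gcd p `|numq x| `|denq x|); rewrite g1 pn pd dvdn1; case: eqP p_pr => [->|].
Qed.

Lemma vdenM x y : (0 < vden x)%N -> (0 < vden y)%N ->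
  vden (x * y) = (vden x + vden y)%N.
Proof.
move=> x0 y0; apply/eqP; rewrite eqn_leq vdenM_le /=.
have nz z : (0 < vden z)%N -> numq z != 0.
  by apply: contraTneq => /eqP; rewrite numq_eq0 => /eqP->; rewrite (vden_int 0).
have e : numq (x * y) * (denq x * denq y) = denq (x * y) * (numq x * numq y).
  apply: (@intr_inj rat); rewrite !intrM.
  have d z : (denq z)%:~R != 0 :> rat by rewrite intr_eq0 denq_neq0.
  have D z : (numq z)%:~R = z * (denq z)%:~R :> rat.
    by rewrite -{2}(divq_num_den z) divfK.
  by rewrite !D; ring.
have nxy : numq (x * y) != 0.
  by rewrite numq_eq0 mulf_neq0 // -numq_eq0 nz.
have := congr1 (fun z => logn p `|z|%N) e; rewrite /= !abszM.
rewrite !lognM ?muln_gt0 ?absz_gt0 ?denq_neq0 ?nxy ?(nz x) ?(nz y) //.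
by rewrite (vden_num x0) (vden_num y0) -!/(vden _); lia.
Qed.

(** Think of [a] and [b] as the traces of two elements [x] and [y] of norm 1 in
    a quadratic field, and of [s], [t] as those of [x y] and [x / y]. Only the
    ultrametric inequality and the additivity of [vden] on products with
    positive values are used: according to whether [vden s] and [vden t]
    agree, the sum or the product of [s] and [t] determines their maximum. *)
Lemma vden_trace (a b s t : rat) : s + t = a * b -> s * t = a ^+ 2 + b ^+ 2 - 4 ->
  maxn (vden s) (vden t) = (vden a + vden b)%N.
Proof.
move=> sum prod.
have ultra x y z : x + y = z -> [/\ (vden x <= maxn (vden y) (vden z))%N,
    (vden y <= maxn (vden x) (vden z))%N &
    (vden z <= maxn (vden x) (vden y))%N].
  move=> <-; split; last exact: vdenD.
    by rewrite -{1}(addrK y x) (leq_trans (vdenD _ _)) // vdenN maxnC.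
  by rewrite -{1}(addKr x y) (leq_trans (vdenD _ _)) // vdenN.
have sq x : vden (x ^+ 2) = (2 * vden x)%N.
  have := vdenM_le x x; have := @vdenM x x; rewrite -expr2.
  by case: (vden x) => [|n]; [lia|move=> ->; lia].
have [h1 h2 h3] := ultra _ _ _ sum.
have [k1 k2 k3] := ultra _ _ _ (esym prod).
have v4 : vden (-4) = 0%N := vden_int (-4).
have [l1 l2 l3] := ultra (a ^+ 2) (b ^+ 2) _ erefl.
have := vdenM_le s t; have := @vdenM s t; have := vdenM_le a b.
have := @vdenM a b; move: h1 h2 h3 k1 k2 k3 l1 l2 l3.
rewrite -sum prod v4 !sq.
move: (vden a) (vden b) (vden s) (vden t) (vden (s + t))
  (vden (a ^+ 2 + b ^+ 2 - 4)) (vden (a ^+ 2 + b ^+ 2)).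
by move=> *; lia.
Qed.

End DenominatorValuation.

Lemma vden_eq0 (x : rat) :
  (forall p, prime p -> vden p x = 0%N) -> x \is a Num.int.
Proof.
move=> x0; suff d1 : denq x = 1 by rewrite Qint_def d1.
apply/eqP; rewrite -[denq x]gez0_abs ?(ltW (denq_gt0 _)) // eqz_nat.
apply/eqP; have d0 : (0 < `|denq x|)%N by rewrite absz_gt0 denq_neq0.
rewrite (prod_prime_decomp d0) big_seq big1 // => -[q e] /mem_prime_decomp[qp e_gt0].
by rewrite pfactor_dvdn // -/(vden q x) x0 // leqNgt e_gt0.
Qed.

(** * Angles with quadratic sine and rational cosine *)

Section Angles.
Variable R : realType.
Implicit Types x y t : R.

Lemma sin_eq0_pi x : sin x = 0 -> exists n : int, x = n%:~R * pi.
Proof.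
move=> sx; exists (Num.floor (x / pi)); apply/eqP; rewrite -subr_eq0; apply/eqP.
set n := Num.floor _; set y := x - _.
have sinD_eq0 (z : R) k : sin z = 0 -> sin (z + pi *+ k) = 0.
  move=> z0; elim: k => [|k IHk]; first by rewrite mulr0n addr0.
  by rewrite mulrS addrCA addrC sinDpi IHk oppr0.
have y0 : sin y = 0.
  rewrite /y mulrzl; case: (n) => k.
    rewrite -oppr0 -(sinD_eq0 (- x) k); first by rewrite -sinN opprD opprK.
    by rewrite sinN sx oppr0.
  by rewrite NegzE mulrNz opprK; apply: sinD_eq0.
have /andP[y_ge0 y_lt] : 0 <= y < pi.
  have := floor_itv (x / pi); rewrite ?num_real // -/n => /andP[].
  rewrite ler_pdivlMr ?pi_gt0 // ltr_pdivrMr ?pi_gt0 // intrD mulrDl mul1r.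
  by rewrite /y; lra.
apply/eqP; case: ltgtP y_ge0 => // y_gt0 _.
by have := sin_gt0_pi; move/(_ R y); rewrite y0 y_gt0 y_lt ltxx => /(_ isT).
Qed.

Lemma cos_int2pi (n : int) : cos (n%:~R * (pi *+ 2)) = 1 :> R.
Proof.
have pos k : cos (pi *+ 2 *+ k) = 1 :> R.
  by rewrite -[_ *+ k]add0r (periodicn (@cosD2pi R)) cos0.
rewrite mulrzl; case: n => k; first by rewrite -pmulrn pos.
by rewrite NegzE mulrNz cosN -pmulrn pos.
Qed.

(** A converse of Niven's theorem: [2 cos t] is one of 0, 1, -1, 2, -2, and in
    each case [cos (6 t)] is 1 or -1. *)
Lemma cos_int_Qpi t (z : int) : 2 * cos t = z%:~R ->
  exists q : rat, t = ratr q * pi.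
Proof.
move=> zE.
have z2 : (- 2 <= z <= 2)%R.
  rewrite -!(ler_int R) -zE; have := cos_geN1 t; have := cos_le1 t.
  by move=> ? ?; apply/andP; split; lra.
have cos6 : `|cos (t *+ 6)| = 1.
  have c3 x : cos (x *+ 3) = 4 * cos x ^+ 3 - 3 * cos x.
    rewrite mulrS cosD cos_mulr2n sin_mulr2n.
    have -> : sin x * ((cos x * sin x) *+ 2) = (cos x *+ 2) * sin x ^+ 2 by ring.
    by rewrite sin2cos2; ring.
  rewrite (mulrnA t 2 3) c3 cos_mulr2n -mulr_natr.
  have -> : cos t = z%:~R / 2 by rewrite -zE mulrC mulKf // pnatr_eq0.
  have : z \in [:: -2; -1; 0; 1; 2] by move: z2; rewrite !inE; lia.
  rewrite !inE => /or4P[|||/orP[]] /eqP->.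
  - by rewrite [X in `|X|](_ : _ = 1) ?normr1 //; field.
  - by rewrite [X in `|X|](_ : _ = 1) ?normr1 //; field.
  - by rewrite [X in `|X|](_ : _ = -1) ?normrN1 //; field.
  - by rewrite [X in `|X|](_ : _ = 1) ?normr1 //; field.
  - by rewrite [X in `|X|](_ : _ = 1) ?normr1 //; field.
have [n tn] := sin_eq0_pi (cos1sin0 cos6).
exists (n%:~R / 6); rewrite fmorph_div /= ratr_int ratr_nat.
by rewrite mulrAC -tn -[t *+ 6]mulr_natr mulfK // pnatr_eq0.
Qed.

End Angles.

Section AngleForms.
Variable R : realType.

(** With [d] the square root of a rational, these are the arguments of the
    elements of norm 1 of the quadratic field generated by [d i]. *)
Definition quadratic_angle (d t : R) : Prop :=
  exists c s : rat, cos t = ratr c /\ sin t = ratr s * d.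

Lemma quadratic_angleB (d : R) (dd : rat) t u : d ^+ 2 = ratr dd ->
  quadratic_angle d t -> quadratic_angle d u -> quadratic_angle d (t - u).
Proof.
move=> d2 [c [s [ct st]]] [c' [s' [cu su]]].
exists (c * c' + s * s' * dd), (s * c' - c * s').
rewrite cosB sinB ct st cu su rmorphB rmorphD !rmorphM /= -d2.
by split; ring.
Qed.

Lemma additive_row (m : nat) (g : 'rV[int]_m -> int) : {morph g : x y / x + y} ->
  forall x, g x = \sum_k x 0 k * g (delta_mx 0 k).
Proof.
move=> gD x; have g0 : g 0 = 0 by apply: (@addrI _ (g 0)); rewrite -gD !addr0.
have gN y : g (- y) = - g y by apply/eqP; rewrite -addr_eq0 -gD addNr g0.
have gMn y k : g (y *+ k) = k%:Z * g y.
  elim: k => [|k IHk]; first by rewrite mulr0n g0 mul0r.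
  by rewrite mulrS gD IHk intS mulrDl mul1r.
have gZ y (z : int) : g (z *: y) = z * g y.
  rewrite -[z in LHS]intz scaler_int; case: z => k; first by rewrite -pmulrn.
  by rewrite NegzE mulrNz gN -pmulrn gMn mulNr.
rewrite {1}(row_sum_delta x) (big_morph g gD g0).
by apply: eq_bigr => k _; rewrite gZ.
Qed.

(** The row [r p] is the form whose absolute value is the exponent of [p] in
    the denominator of [2 cos], supplied by [vden_trace] and [max_additive]. It
    vanishes on rational multiples of [pi] because some multiple of such an
    angle has cosine 1. If all forms vanish on a combination, its [2 cos] is an
    integer, and [cos_int_Qpi] applies. *)
Lemma valuation_forms m (t : 'I_m -> R) (d : R) (dd : rat) :
    d ^+ 2 = ratr dd -> (forall k, quadratic_angle d (t k)) ->
  exists r : nat -> 'I_m -> int,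
    (forall p k (X : nat) (z : int), prime p -> X != 0%N ->
       X%:R * (2 * cos (t k)) = z%:~R -> (`|r p k| <= logn p X)%N) /\
    (forall x : 'I_m -> int,
       (forall p, prime p -> \sum_k x k * r p k = 0) <->
       exists q : rat, \sum_k (x k)%:~R * t k = ratr q * pi).
Proof.
move=> d2 tq; pose ang (x : 'rV[int]_m) : R := \sum_k (x 0 k)%:~R * t k.
have angB x y : ang (x - y) = ang x - ang y.
  by rewrite /ang -sumrB; apply: eq_bigr => k _; rewrite !mxE intrB mulrBl.
have ang0 : ang 0 = 0 by rewrite -[0]subr0 angB subrr.
have angD x y : ang (x + y) = ang x + ang y.
  by rewrite -{1}[y]opprK angB -sub0r angB ang0 sub0r opprK.
have angdelta k : ang (delta_mx 0 k) = t k.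
  rewrite /ang (bigD1 k) //= big1 => [|j jk]; last first.
    by rewrite mxE (negPf jk) andbF mul0r.
  by rewrite mxE !eqxx mul1r addr0.
have angq x : quadratic_angle d (ang x).
  have q0 : quadratic_angle d 0.
    by exists 1, 0; rewrite cos0 sin0 rmorph0 rmorph1 mul0r.
  have qB := quadratic_angleB d2.
  have qD a b : quadratic_angle d a -> quadratic_angle d b ->
      quadratic_angle d (a + b).
    by move=> qa qb; rewrite -[b]opprK; apply/qB => //; rewrite -sub0r; apply: qB.
  have qMn a k : quadratic_angle d a -> quadratic_angle d (a *+ k).
    by move=> qa; elim: k => [|k]; rewrite ?mulr0n // mulrS; apply: qD.
  apply: (big_ind (quadratic_angle d)) => // k _.
  rewrite mulrzl; case: (x 0 k) => n; first by rewrite -pmulrn; apply: qMn.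
  by rewrite NegzE mulrNz -pmulrn -sub0r; apply/qB/qMn.
have /choice[c cE] x : exists c : rat, ratr c = 2 * cos (ang x).
  have [c [s [cx _]]] := angq x; exists (2 * c).
  by rewrite rmorphM /= ratr_nat cx.
have inj := fmorph_inj (ratr : rat -> R).
have form p : exists r : 'I_m -> int, prime p ->
    forall x, vden p (c x) = `|(\sum_k x 0 k * r k)%R|%N.
  have [p_pr|] := boolP (prime p); last by exists (fun=> 0).
  have [|g [gD gE]] := @max_additive _ (fun x => vden p (c x)).
    move=> x y; apply: vden_trace => //; apply: inj.
      rewrite rmorphD rmorphM /= !cE angD angB cosD cosB; ring.
    rewrite rmorphB rmorphD rmorphM !rmorphXn /= ratr_nat !cE angD angB cosD cosB.
    have := sin2cos2 (ang x); have := sin2cos2 (ang y).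
    move: (cos (ang x)) (sin (ang x)) (cos (ang y)) (sin (ang y)) => a u b v.
    move=> h1 h2.
    have -> : 2 * (a * b - u * v) * (2 * (a * b + u * v)) =
        4 * (a ^+ 2 * b ^+ 2 - u ^+ 2 * v ^+ 2) by ring.
    by rewrite h1 h2; ring.
  by exists (fun k => g (delta_mx 0 k)) => _ x; rewrite gE (additive_row gD).
have [r rE] := choice form; exists r; split.
  move=> p k X z p_pr X0 Xz.
  have <- : vden p (c (delta_mx 0 k)) = `|r p k|%N.
    rewrite rE // (bigD1 k) //= big1 => [|j jk]; last first.
      by rewrite mxE (negPf jk) andbF mul0r.
    by rewrite mxE !eqxx mul1r addr0.
  apply: (@vden_le p _ z X%:Z); first by rewrite eqz_nat.
  by apply: inj; rewrite rmorphM /= cE angdelta !ratr_int -Xz mulrC -pmulrn.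
move=> x; pose xr := \row_k x k.
have -> : \sum_k (x k)%:~R * t k = ang xr by apply: eq_bigr => k _; rewrite mxE.
have rx p : prime p -> vden p (c xr) = `|(\sum_k x k * r p k)%R|%N.
  by move=> /rE->; congr `|_|%N; apply: eq_bigr => k _; rewrite mxE.
split=> [x0|[q aq] p p_pr].
  have /intrP[z cz] : c xr \is a Num.int.
    by apply: vden_eq0 => p p_pr; rewrite rx // x0.
  by apply: (@cos_int_Qpi R _ z); rewrite -cE cz ratr_int.
pose D := (2 * `|denq q|)%N.
have angMn k : ang (xr *+ k) = ang xr *+ k.
  by elim: k => [|k IHk]; rewrite ?mulr0n // !mulrS angD IHk.
have cD : c (xr *+ D) = 2.
  apply: inj; rewrite /= cE angMn ratr_nat.
  have -> : ang xr *+ D = (numq q)%:~R * (pi *+ 2).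
    rewrite aq -mulr_natr /D natrM -(ratr_int R (numq q)).
    have -> : (`|denq q|%N)%:R = ratr (denq q)%:~R :> R.
      by rewrite ratr_int pmulrn gez0_abs // ltW.
    rewrite -{1}(divq_num_den q) fmorph_div /= -mulr_natr.
    have : ratr (denq q)%:~R != 0 :> R by rewrite fmorph_eq0 intr_eq0 denq_neq0.
    by move: (ratr _) (ratr _) => a b b0; field.
  by rewrite cos_int2pi mulr1.
have := rE p p_pr (xr *+ D); rewrite cD (vden_int p 2) => /esym/eqP.
have -> : \sum_k (xr *+ D) 0 k * r p k = (\sum_k x k * r p k) *+ D.
  rewrite -sumrMnl; apply: eq_bigr => k _.
  by rewrite -scaler_nat !mxE mulr_natl mulrnAl.
rewrite absz_eq0 mulrn_eq0 muln_eq0 absz_eq0 (negPf (denq_neq0 _)) /=.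
by move/eqP.
Qed.

End AngleForms.

(** * Small vectors in the common kernel of integral forms *)

Lemma det_norm_le (T : realDomainType) m (A : 'M[T]_m) :
  `|\det A| <= \prod_i \sum_j `|A i j|.
Proof.
rewrite bigA_distr_bigA /=; apply: le_trans (ler_norm_sum _ _ _) _.
pose h (s : 'S_m) : {ffun 'I_m -> 'I_m} := finfun s.
have h_inj : injective h.
  by move=> s s' /ffunP ss; apply/permP => i; have := ss i; rewrite !ffunE.
rewrite (eq_bigr (fun s : 'S_m => \prod_i `|A i (h s i)|)); last first.
  move=> s _; rewrite normrM normrX normrN1 expr1n mul1r normr_prod.
  by apply: eq_bigr => i _; rewrite ffunE.
rewrite -(big_imset (fun f : {ffun 'I_m -> 'I_m} => \prod_i `|A i (f i)|)) /=;
  last by move=> s s' _ _; apply: h_inj.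
rewrite [leRHS](bigID [in h @: 'S_m]) /= lerDl.
by apply: sumr_ge0 => f _; apply: prodr_ge0.
Qed.

(** The forms have a one-dimensional common kernel, so [m] of them span the
    others. The vector of their signed maximal minors is orthogonal to each of
    them by expansion of a determinant with a repeated row, and it is nonzero
    because adjoining the row [n], which is orthogonal to the others, gives a
    nonsingular matrix. *)
Lemma kernel_cofactor_bound m B (r : 'I_B -> 'I_m.+1 -> int)
    (n : 'I_m.+1 -> nat) :
    (forall k, (0 < n k)%N) ->
    (forall p, \sum_k (n k)%:Z * r p k = 0) ->
    (forall x : 'I_m.+1 -> int, (forall p, \sum_k x k * r p k = 0) ->
      forall i j, x i * (n j)%:Z = x j * (n i)%:Z) ->
  exists (g : 'I_m -> 'I_B) (M : 'I_m.+1 -> int),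
    [/\ injective g, exists k, M k != 0,
        forall i j, M i * (n j)%:Z = M j * (n i)%:Z &
        forall k, (`|M k| <= \prod_i \sum_j `|r (g i) j|)%N].
Proof.
move=> n_gt0 rn ker_r.
pose A : 'M[rat]_(B, m.+1) := \matrix_(p, k) (r p k)%:~R.
pose nr : 'rV[rat]_m.+1 := \row_k (n k)%:R.
have nr0 k : nr 0 k != 0 by rewrite mxE pnatr_eq0 -lt0n.
have kerA (x : 'rV[rat]_m.+1) : x *m A^T = 0 -> (x <= nr)%MS.
  move=> xA; have [d [z [d_gt0 dz]]] := common_denominator (x 0).
  have d0 : d%:R != 0 :> rat by rewrite pnatr_eq0 -lt0n.
  have z0 p : \sum_k z k * r p k = 0.
    apply: (@intr_inj rat); rewrite rmorph_sum /=.
    have /matrixP/(_ 0 p) := xA; rewrite !mxE => xp.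
    transitivity (d%:R * (\sum_j x 0 j * A^T j p)); last by rewrite xp mulr0.
    by rewrite mulr_sumr; apply: eq_bigr => k _; rewrite intrM -dz !mxE; ring.
  apply/sub_rVP; exists (x 0 0 / nr 0 0); apply/rowP => k; rewrite mxE.
  apply: (mulIf (nr0 0)); rewrite mulrAC divfK //; apply: (mulIf d0).
  rewrite mulrAC dz -[in RHS]mulrA [_ * d%:R]mulrC mulrA dz !mxE !pmulrn -!intrM.
  by rewrite ker_r.
have nrA : nr *m A^T = 0.
  apply/rowP => p; rewrite !mxE -[RHS](rmorph0 (intr : int -> rat)) -(rn p).
  by rewrite rmorph_sum; apply: eq_bigr => k _; rewrite !mxE rmorphM /= -pmulrn.
have rkA : \rank A = m.
  have kE : (kermx A^T :=: nr)%MS.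
    apply/eqmxP/andP; split; last by apply/sub_kermxP.
    by apply/row_subP => i; apply: kerA; apply/sub_kermxP; apply: row_sub.
  have := mxrank_ker A^T; rewrite kE mxrank_tr rank_rV.
  have -> : nr != 0 by apply: contraNneq (nr0 0) => ->; rewrite mxE.
  by have := rank_leq_col A; lia.
have [g [g_inj gA]] : exists g : 'I_m -> 'I_B,
    injective g /\ (A <= rowsub g A)%MS.
  have := @maxrankfun_inj _ _ _ A; have := eq_maxrowsub A.
  move: (maxrankfun A); rewrite rkA => f fA f_inj; exists f; split=> //.
  by rewrite fA.
pose C : 'M[int]_(1 + m) :=
  col_mx (\row_k (n k)%:Z) (\matrix_(i, k) r (g i) k).
have [M ME] : exists M : 'I_(1 + m) -> int,
    forall k, M k = cofactor C (lshift m ord0) k by exists (cofactor C (lshift m ord0)).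
have C0 k : C (lshift m ord0) k = (n k)%:Z by rewrite col_mxEu mxE.
have C1 i k : C (rshift 1 i) k = r (g i) k by rewrite col_mxEd mxE.
have kerC (x : 'rV[rat]_m.+1) : (forall i, \sum_k x 0 k * (r (g i) k)%:~R = 0) ->
    (x <= nr)%MS.
  move=> xC; apply: kerA; have /submxP[D ->] := gA.
  rewrite trmx_mul mulmxA; suff -> : x *m (rowsub g A)^T = 0 by rewrite mul0mx.
  by apply/rowP => i; rewrite !mxE -[RHS](xC i); apply: eq_bigr => k _; rewrite !mxE.
have MC i : \sum_k M k * r (g i) k = 0.
  have := mul_mx_adj C => /matrixP/(_ (rshift 1 i) (lshift m ord0)).
  rewrite !mxE /= => CM; rewrite -[RHS]CM; apply: eq_bigr => k _.
  by rewrite C1 ME !mxE mulrC.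
exists g, M; split=> //.
- have [k Mk|M0] := pickP (fun k => M k != 0); first by exists k.
  have detC : \det C = 0.
    rewrite (expand_det_row C (lshift m ord0)) big1 // => k _.
    by have /negbFE/eqP := M0 k; rewrite ME => ->; rewrite mulr0.
  have /eqP/det0P[x x0 /matrixP xC] : \det (map_mx intr C : 'M[rat]_(1 + m))^T = 0.
    by rewrite det_tr det_map_mx detC.
  have /sub_rVP[a xE] : (x <= nr)%MS.
    apply: kerC => i; transitivity ((x *m (map_mx intr C)^T) 0 (rshift 1 i)).
      by rewrite mxE; apply: eq_bigr => k _; rewrite 2!mxE C1.
    by rewrite xC mxE.
  have := xC 0 (lshift m ord0); rewrite mxE [RHS]mxE => /eqP.
  rewrite (eq_bigr (fun k => a * (nr 0 k ^+ 2))) => [|k _]; last first.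
    by rewrite 2!mxE C0 xE !mxE; ring.
  rewrite -mulr_sumr mulf_eq0 psumr_eq0 => [|k _]; last exact: sqr_ge0.
  case/orP => [/eqP a0|/allP/(_ ord0)].
    by move: x0; rewrite xE a0 scale0r eqxx.
  by rewrite mem_index_enum => /(_ isT) /=; rewrite sqrf_eq0 (negPf (nr0 _)).
- pose Mr : 'rV[rat]_m.+1 := \row_k (M k)%:~R.
  have /sub_rVP[a aE] : (Mr <= nr)%MS.
    apply: kerC => i; rewrite -[RHS](rmorph0 (intr : int -> rat)) -(MC i).
    by rewrite rmorph_sum; apply: eq_bigr => k _; rewrite mxE -intrM.
  have Ma k : (M k)%:~R = a * (n k)%:R by move/rowP/(_ k): aE; rewrite !mxE.
  by move=> i j; apply: (@intr_inj rat); rewrite !intrM !Ma -!pmulrn; ring.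
- move=> k; rewrite -lez_nat abszE ME /cofactor normrM normrX normrN1 expr1n mul1r.
  apply: le_trans (det_norm_le _) _; rewrite -natz natr_prod.
  apply: ler_prod => i _; rewrite sumr_ge0 //= natr_sum.
  rewrite [leRHS](bigD1_ord k) //= ler_wpDl // ler_sum // => j _.
  have li : lift (lshift m ord0) i = rshift 1 i by apply: val_inj.
  by rewrite natz abszE 2!mxE li C1.
Qed.

(** * A numerical inequality *)

(** The final comparison in units of [t = 10 ^ 12], which keeps all numbers
    small. *)
Lemma power_gap (F : realFieldType) (a t u v w : F) :
    0 < t -> 0 <= a -> a <= 2 * t -> 39 / 10 * t <= u -> 24 / 5 <= v ->
    28 / 100 * t <= w ->
  a ^+ 6 * 2 < u ^+ 5 * (v * w).
Proof.
move=> t0 a0 at2 tu v_ge tw.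
have h39 : 0 <= 39 / 10 :> F by lra.
have h28 : 0 <= 28 / 100 :> F by lra.
have h24 : 0 <= 24 / 5 :> F by lra.
have s0 : 0 <= 39 / 10 * t by exact: mulr_ge0 h39 (ltW t0).
have w0 : 0 <= 28 / 100 * t by exact: mulr_ge0 h28 (ltW t0).
apply: (@le_lt_trans _ _ ((2 * t) ^+ 6 * 2)).
  apply: ler_wpM2r; first exact: ler0n.
  by apply: (lerXn2r _ _ _ at2); rewrite nnegrE //; apply: le_trans a0 at2.
apply: (@lt_le_trans _ _ ((39 / 10 * t) ^+ 5 * (24 / 5 * (28 / 100 * t)))).
  clear -t0; rewrite -subr_gt0.
  have -> : (39 / 10 * t) ^+ 5 * (24 / 5 * (28 / 100 * t)) - (2 * t) ^+ 6 * 2 =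
    ((39 / 10) ^+ 5 * (24 / 5 * (28 / 100)) - 128) * t ^+ 6 by ring.
  by apply: mulr_gt0 (exprn_gt0 _ t0); clear; lra.
apply: ler_pM; first exact: exprn_ge0 s0.
- exact: mulr_ge0 h24 w0.
- by apply: (lerXn2r _ _ _ tu); rewrite nnegrE; [exact: s0|exact: le_trans tu].
- exact: ler_pM h24 w0 v_ge tw.
Qed.

Lemma numeric_gap (F : realFieldType) :
  243 ^+ 6 * 96 ^+ 30 * 2 <
  (3946 * 10 ^+ 9) ^+ 5 * ((13 / 10) ^+ 6 * (5 / 4) ^+ 120) :> F.
Proof.
have -> : 243 ^+ 6 * 96 ^+ 30 = (96 ^+ 5 * 243) ^+ 6 :> F.
  by rewrite exprMn -exprM mulrC.
rewrite (exprM (5 / 4 : F) 10 12); apply: (@power_gap _ _ (10 ^+ 12)).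
- exact/exprn_gt0/ltr0n.
- exact: mulr_ge0 (exprn_ge0 _ (ler0n _ _)) (ler0n _ _).
- by lra.
- by lra.
- by lra.
have d1 : 9 <= (5 / 4) ^+ 10 :> F by lra.
apply: (@le_trans _ _ (9 ^+ 12)); first by clear; lra.
by apply: (lerXn2r _ _ _ d1); rewrite nnegrE; [exact: ler0n|exact: le_trans d1].
Qed.

Section Numerics.
Variable R : realType.

Lemma ln_succ_ge (k : nat) : (0 < k)%N -> ln (k%:R : R) + k.+1%:R^-1 <= ln k.+1%:R.
Proof.
move=> k_gt0; have k0 : 0 < k%:R :> R by rewrite ltr0n.
have k1 : 0 < k.+1%:R :> R by rewrite ltr0n.
have : -1 < - k.+1%:R^-1 :> R by rewrite ltrN2 invf_lt1 // ltr1n.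
move/le_ln1Dx.
have -> : 1 + - k.+1%:R^-1 = k%:R / k.+1%:R :> R.
  by rewrite -natr1 in k1 *; field; rewrite lt0r_neq0.
rewrite ln_div ?posrE //.
by move: (ln _) (ln _) (_^-1) => a b c; lra.
Qed.

(** After sorting, the entries are at least 2, 3, 4, 5 and 6. *)
Lemma prod_ln_ge (s : seq nat) : size s = 5%N -> uniq s -> all (leq 2) s ->
  13 / 10 <= \prod_(x <- s) ln (x%:R : R).
Proof.
move=> szs us s2; have ss : sorted ltn (sort leq s).
  by rewrite ltn_sorted_uniq_leq sort_uniq us sort_sorted //; apply: leq_total.
have {}s2 : all (leq 2) (sort leq s) by rewrite all_sort.
have <- : \prod_(x <- sort leq s) ln (x%:R : R) = \prod_(x <- s) ln x%:R.
  by apply: perm_big; rewrite perm_sort.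
move: szs ss s2; rewrite -(size_sort leq).
case: (sort leq s) => [|a[|b[|c[|d[|e[|]]]]]] //= _.
case/and5P => ab bc cd de _ /andP[a2 _].
have ln2 : 7 / 12 <= ln 2 :> R.
  have -> : 2 = ((1 + - (1/4)) * (1 + - (1/3)))^-1 :> R by field.
  rewrite lnV ?posrE ?lnM ?posrE; try lra.
  have := @le_ln1Dx R (- (1/4)); have := @le_ln1Dx R (- (1/3)).
  by move=> /(_ ltac:(lra)) ? /(_ ltac:(lra)) ?; lra.
have ln3 : 11 / 12 <= ln 3 :> R.
  by have := @ln_succ_ge 2 isT; move: ln2; clear; lra.
have ln4 : 7 / 6 <= ln 4 :> R.
  by have := @ln_succ_ge 3 isT; move: ln3; clear; lra.
have ln5 : 41 / 30 <= ln 5 :> R.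
  by have := @ln_succ_ge 4 isT; move: ln4; clear; lra.
have ln6 : 23 / 15 <= ln 6 :> R.
  by have := @ln_succ_ge 5 isT; move: ln5; clear; lra.
have mono (k x : nat) : (0 < k)%N -> (k <= x)%N -> ln (k%:R : R) <= ln x%:R.
  move=> k0 kx; rewrite ler_ln ?posrE ?ltr0n ?ler_nat //.
  exact: leq_trans kx.
have la : 7 / 12 <= ln (a%:R : R) by apply: le_trans (mono 2%N a isT a2).
have lb : 11 / 12 <= ln (b%:R : R) by apply: le_trans ln3 (mono 3%N b isT _); lia.
have lc : 7 / 6 <= ln (c%:R : R) by apply: le_trans ln4 (mono 4%N c isT _); lia.
have ld : 41 / 30 <= ln (d%:R : R).
  by apply: le_trans ln5 (mono 5%N d isT _); lia.
have le : 23 / 15 <= ln (e%:R : R).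
  by apply: le_trans ln6 (mono 6%N e isT _); lia.
move: la lb lc ld le; clear => la lb lc ld le.
rewrite !big_cons big_nil mulr1.
apply: (@le_trans _ _ (7 / 12 * (11 / 12 * (7 / 6 * (41 / 30 * (23 / 15)))))).
  lra.
by do !apply: ler_pM => //; lra.
Qed.

(** Taking logarithms, [T = sum S i ln (p i)] is at most [8 ln 2 + 16 ln N],
    while [x <= 96 exp (x / 96 - 1)] at [x = S i ln (p i)] bounds the product
    of the [S i] by a multiple of [exp (T / 96)], that is, of the sixth root of
    [N]. The tangent of the exponential is taken at 1, so the loss is least
    when every [S i ln (p i)] is close to 96; this is about [T / 5] for [N] in
    the critical range. The logarithms of five distinct integers above 1
    multiply to more than 1. *)
Lemma logarithmic_bound (p S : 'I_5 -> nat) (N : nat) :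
    injective p -> (forall i, (1 < p i)%N) ->
    (\prod_i p i ^ S i <= 256 * N ^ 16)%N ->
    (N <= 243 * \prod_i S i)%N ->
  N%:R <= 3946 * 10 ^+ 9 :> R.
Proof.
move=> p_inj p_gt1 le_prod le_N.
have [->|N_gt0] := posnP N; first by apply: mulr_ge0; [apply: ler0n|apply/exprn_ge0/ler0n].
have N0 : 0 < N%:R :> R by rewrite ltr0n.
pose L : R := \prod_i ln (p i)%:R.
have L_ge : 13 / 10 <= L.
  rewrite /L -big_enum /= -(big_map p predT (fun x => ln (x%:R : R))).
  apply: prod_ln_ge; first by rewrite size_map size_enum_ord.
    by rewrite map_inj_uniq // enum_uniq.
  by apply/allP => _ /mapP[i _ ->].
have lnp i : 0 < ln (p i)%:R :> R by rewrite ln_gt0 // ltr1n.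
pose T : R := \sum_i (S i)%:R * ln (p i)%:R.
have T_le : T <= 8 * ln 2 + 16 * ln N%:R.
  have -> : T = ln (\prod_i p i ^ S i)%N%:R.
    rewrite -[LHS]expRK; congr ln; rewrite expR_sum natr_prod.
    apply: eq_bigr => i _; rewrite expRM_natl natrX lnK // posrE ltr0n.
    exact: ltnW (p_gt1 i).
  have -> : 8 * ln 2 + 16 * ln N%:R = ln (256 * N ^ 16)%N%:R :> R.
    have N16 : 0 < N%:R ^+ 16 :> R by exact: exprn_gt0.
    have two8 : 0 < 2 ^+ 8 :> R by apply: exprn_gt0; apply: ltr0n.
    have e256 : 256 = 2 ^+ 8 :> R by ring.
    rewrite natrM natrX e256 (lnM two8 N16) (lnXn _ N0) (lnXn _ (ltr0n R 2)).
    by rewrite -[ln 2 *+ 8]mulr_natl -[ln N%:R *+ 16]mulr_natl.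
  rewrite ler_ln ?posrE ?ltr0n ?ler_nat ?muln_gt0 ?expn_gt0 ?N_gt0 //.
  by apply: prodn_gt0 => i; rewrite expn_gt0 (ltnW (p_gt1 i)).
have PL : ((\prod_i S i)%N%:R * L) <= 96 ^+ 5 * expR (T / 96 - 5) :> R.
  have -> : 96 ^+ 5 * expR (T / 96 - 5) =
      \prod_i (96 * expR ((S i)%:R * ln (p i)%:R / 96 - 1)) :> R.
    rewrite big_split /= prodr_const card_ord -expR_sum; congr (_ * expR _).
    by rewrite sumrB -mulr_suml sumr_const card_ord.
  rewrite natr_prod -big_split /=; apply: ler_prod => i _.
  rewrite mulr_ge0 ?(ltW (lnp i)) //=.
  rewrite -ler_pdivrMl //.
  have := expR_ge1Dx ((S i)%:R * ln (p i)%:R / 96 - 1 : R).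
  by rewrite addrC subrK mulrC.
have e30 : expR (-30) * (5 / 4) ^+ 120 <= 1 :> R.
  rewrite expRN mulrC ler_pdivrMr ?expR_gt0 // mul1r.
  have -> : expR 30 = expR (1/4) ^+ 120 :> R.
    by rewrite -expRM_natl; congr expR; field.
  have e14 : 5 / 4 <= expR (1 / 4) :> R.
    by apply: le_trans (expR_ge1Dx _); lra.
  by apply: lerXn2r e14; rewrite nnegrE ?expR_ge0 //; lra.
have main : (N%:R * L) ^+ 6 <= 243 ^+ 6 * (96 ^+ 30 * (2 * N%:R * expR (-30))).
  have L0 : 0 <= L by lra.
  have -> : 243 ^+ 6 * (96 ^+ 30 * (2 * N%:R * expR (-30))) =
    (243 * 96 ^+ 5) ^+ 6 * (2 * N%:R * expR (-30)) :> R by ring.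
  apply: (@le_trans _ _ ((243 * (96 ^+ 5 * expR (T / 96 - 5))) ^+ 6)).
    apply: lerXn2r; rewrite ?nnegrE.
    - exact: mulr_ge0 (ler0n _ _) L0.
    - apply: mulr_ge0; first exact: ler0n.
      by apply: mulr_ge0; [apply/exprn_ge0/ler0n|apply: expR_ge0].
    apply: le_trans (ler_wpM2l (ler0n _ _) PL); rewrite mulrA.
    by apply: (ler_wpM2r L0); rewrite -natrM ler_nat.
  have c0 : 0 < (243 * 96 ^+ 5) ^+ 6 :> R.
    by apply/exprn_gt0/mulr_gt0; [apply: ltr0n|apply/exprn_gt0/ltr0n].
  rewrite [X in X ^+ 6]mulrA exprMn (ler_pM2l c0).
  rewrite -expRM_natl.
  have -> : 2 * N%:R * expR (-30) = expR (ln 2 + ln N%:R - 30) :> R.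
    by rewrite !expRD !lnK ?posrE.
  rewrite ler_expR; have : 0 <= ln 2 :> R by rewrite ln_ge0 // ler1n.
  by move: T_le; lra.
(* Cancel one factor N and replace exp (-30) by its bound (5/4)^(-120). *)
have {}main :
    N%:R ^+ 5 * ((13 / 10) ^+ 6 * (5 / 4) ^+ 120) <= 243 ^+ 6 * 96 ^+ 30 * 2 :> R.
  move: e30 main; move: (243 ^+ 6) (exprn_ge0 6 (ler0n R 243)) => A A0.
  move: (96 ^+ 30) (exprn_ge0 30 (ler0n R 96)) => B B0.
  have : 0 <= (5 / 4) ^+ 120 :> R by apply: exprn_ge0; lra.
  move: ((5 / 4) ^+ 120) (expR _) => Q E Q0 EQ main.
  have L6 : (13 / 10) ^+ 6 <= L ^+ 6 by apply: lerXn2r; rewrite ?nnegrE; lra.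
  have {}main : N%:R ^+ 5 * L ^+ 6 <= A * B * 2 * E.
    rewrite -(ler_pM2l N0) (_ : _ * (_ * _) = (N%:R * L) ^+ 6); last by ring.
    by apply: le_trans main _; rewrite le_eqVlt; apply/orP; left; apply/eqP; ring.
  apply: (@le_trans _ _ (N%:R ^+ 5 * L ^+ 6 * Q)).
    rewrite -mulrA; apply: ler_wpM2l; first exact/exprn_ge0/ler0n.
    exact: ler_wpM2r.
  apply: le_trans (ler_wpM2r Q0 main) _; rewrite -mulrA.
  by apply: ler_piMr => //; do 2 apply: mulr_ge0 => //.
rewrite leNgt; apply/negP => ltN; move: main; apply/negP; rewrite -ltNge.
apply: (@lt_trans _ _ ((3946 * 10 ^+ 9) ^+ 5 *
    ((13 / 10) ^+ 6 * (5 / 4) ^+ 120))); last first.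
  rewrite ltr_pM2r; last by clear; apply: mulr_gt0; apply: exprn_gt0; lra.
  have X0 : 3946 * 10 ^+ 9 \in @Num.nneg R.
    by rewrite nnegrE; apply: mulr_ge0; [apply: ler0n|apply/exprn_ge0/ler0n].
  have N1 : N%:R \in @Num.nneg R by rewrite nnegrE ler0n.
  by rewrite (ltr_pXn2r (isT : 0 < 5)%N X0 N1); exact: ltN.
exact: numeric_gap.
Qed.

End Numerics.

(** * Dihedral angles in terms of edge lengths *)

Section Geometry.
Variable R : realType.
Implicit Types (x y z e a b : 'rV[R]_3).

Lemma dotE x y : dot x y = \sum_k x 0 k * y 0 k.
Proof. by rewrite /dot mxE; apply: eq_bigr => k _; rewrite mxE. Qed.

Lemma dotC x y : dot x y = dot y x.
Proof. by rewrite !dotE; apply: eq_bigr => k _; rewrite mulrC. Qed.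

Lemma dotBl x y z : dot (x - y) z = dot x z - dot y z.
Proof. by rewrite /dot mulmxBl !mxE. Qed.

Lemma dotBr x y z : dot z (x - y) = dot z x - dot z y.
Proof. by rewrite !(dotC z) dotBl. Qed.

Lemma dotZl k x y : dot (k *: x) y = k * dot x y.
Proof. by rewrite /dot -scalemxAl mxE. Qed.

Lemma dotZr k x y : dot x (k *: y) = k * dot x y.
Proof. by rewrite !(dotC x) dotZl. Qed.

Lemma dotNl x y : dot (- x) y = - dot x y.
Proof. by rewrite -scaleN1r dotZl mulN1r. Qed.

Lemma dotNr x y : dot x (- y) = - dot x y.
Proof. by rewrite dotC dotNl dotC. Qed.

Lemma dot_ge0 x : 0 <= dot x x.
Proof. by rewrite dotE sumr_ge0 // => k _; rewrite -expr2 sqr_ge0. Qed.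

Lemma sqr_enorm x : enorm x ^+ 2 = dot x x.
Proof. by rewrite sqr_sqrtr // dot_ge0. Qed.

(** Sixteen times the squared area of a triangle with squared side lengths [p],
    [q] and [r]. *)
Definition heron (T : pzRingType) (p q r : T) : T := 4 * p * q - (p + q - r) ^+ 2.

(** The Gram determinant of [e], [a] and [b]. *)
Definition gram e a b : R :=
  dot e e * dot a a * dot b b + 2 * dot a e * dot b e * dot a b
  - dot e e * dot a b ^+ 2 - dot a a * dot b e ^+ 2 - dot b b * dot a e ^+ 2.

(** [A] and [B] are sixteen times the squared areas of the faces spanned by
    [e], [a] and by [e], [b]. The cosine is [C / sqrt (A B)], and the identity
    [A B - C ^ 2 = 16 E G] gives the sine as a multiple of the square root of
    the Gram determinant [G], which does not depend on the edge. *)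
Lemma double_angle_orth_part e a b (E := dot e e)
    (A := 4 * (E * dot a a - dot a e ^+ 2))
    (B := 4 * (E * dot b b - dot b e ^+ 2))
    (C := 4 * (E * dot a b - dot a e * dot b e)) :
    0 < gram e a b ->
  [/\ 0 < A, 0 < B,
      cos (2 * angle (orth_part e a) (orth_part e b)) = 2 * C ^+ 2 / (A * B) - 1 &
      sin (2 * angle (orth_part e a) (orth_part e b)) =
        8 * C * enorm e / (A * B) * Num.sqrt (gram e a b)].
Proof.
move=> G_gt0; set G := gram e a b in G_gt0 *.
have E_gt0 : 0 < E.
  rewrite lt_def dot_ge0 andbT; apply: contraTneq G_gt0 => E0.
  have e0 : e = 0.
    apply/rowP => k; rewrite mxE; move/eqP: E0; rewrite /E dotE psumr_eq0.
      by move=> /allP/(_ k); rewrite mem_index_enum -expr2 sqrf_eq0 => /(_ isT)/eqP.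
    by move=> j _; rewrite -expr2 sqr_ge0.
  have d0 y : dot y e = 0 by rewrite e0 -(scale0r e) dotZr mul0r.
  rewrite -leNgt /G /gram !d0.
  by rewrite le_eqVlt; apply/orP; left; apply/eqP; ring.
have E_neq0 := lt0r_neq0 E_gt0.
have orthD y z : dot (orth_part e y) (orth_part e z) =
    (4 * (E * dot y z - dot y e * dot z e)) / (4 * E).
  rewrite /orth_part !(dotBl, dotBr, dotZl, dotZr) (dotC e z) -/E.
  by field.
have E4 : 0 < 4 * E by rewrite mulr_gt0.
have oaa : dot (orth_part e a) (orth_part e a) = A / (4 * E).
  by rewrite orthD -expr2.
have obb : dot (orth_part e b) (orth_part e b) = B / (4 * E).
  by rewrite orthD -expr2.
have A_ge0 : 0 <= A.
  by have := dot_ge0 (orth_part e a); rewrite oaa pmulr_lge0 ?invr_gt0.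
have B_ge0 : 0 <= B.
  by have := dot_ge0 (orth_part e b); rewrite obb pmulr_lge0 ?invr_gt0.
have AB : A * B - C ^+ 2 = 16 * E * G by rewrite /A /B /C /G /gram -/E; ring.
have AB_gt0 : 0 < A * B.
  have -> : A * B = 16 * E * G + C ^+ 2 by rewrite -AB subrK.
  by rewrite ltr_wpDr ?sqr_ge0 // !mulr_gt0.
have A_gt0 : 0 < A.
  by rewrite lt_def A_ge0 andbT; apply: contraTneq AB_gt0 => ->; rewrite mul0r ltxx.
have B_gt0 : 0 < B.
  by rewrite lt_def B_ge0 andbT; apply: contraTneq AB_gt0 => ->; rewrite mulr0 ltxx.
set t := angle _ _; pose s := Num.sqrt (A * B).
have s_gt0 : 0 < s by rewrite sqrtr_gt0.
have s_neq0 := lt0r_neq0 s_gt0.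
have s2 : s ^+ 2 = A * B by rewrite sqr_sqrtr // ltW.
have AB_neq0 := lt0r_neq0 AB_gt0.
have tE : t = acos (C / s).
  rewrite /t /angle orthD -/C /enorm oaa obb -sqrtrM ?divr_ge0 ?(ltW E4) //.
  have -> : A / (4 * E) * (B / (4 * E)) = (A * B) / (4 * E) ^+ 2 by field.
  rewrite sqrtrM ?(ltW AB_gt0) // sqrtrV ?sqr_ge0 // sqrtr_sqr gtr0_norm // -/s.
  by congr acos; field; rewrite E_neq0 s_neq0.
have X2 : (C / s) ^+ 2 = C ^+ 2 / (A * B) by rewrite expr_div_n s2.
have oneB : 1 - (C / s) ^+ 2 = 16 * E * G / (A * B).
  by rewrite X2 -AB mulrBl divff.
have X1 : -1 <= C / s <= 1.
  rewrite -ler_norml -sqrtr_sqr -[leRHS]sqrtr1 ler_sqrt // -subr_ge0 oneB.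
  by rewrite divr_ge0 ?(ltW AB_gt0) // !mulr_ge0 // ltW.
have cost : cos t = C / s by rewrite tE acosK // in_itv.
have sint : sin t = 4 * enorm e * Num.sqrt G / s.
  rewrite tE sin_acos // oneB sqrtrM ?sqrtrV ?(ltW AB_gt0) -/s //; last first.
    by rewrite !mulr_ge0 // ltW.
  rewrite sqrtrM; last by rewrite mulr_ge0 // ltW.
  rewrite sqrtrM //; congr (_ * _ * _ / _).
  have -> : 16 = 4 ^+ 2 :> R by ring.
  by rewrite sqrtr_sqr ger0_norm.
have twice (x : R) : 2 * x = x *+ 2 by rewrite mulr_natl.
split=> //; rewrite [in LHS]twice.
  by rewrite cos_mulr2n cost X2 -mulr_natl mulrA.
rewrite sin_mulr2n cost sint -mulr_natl -s2; field; exact: s_neq0.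
Qed.

Lemma gram_det (M : 'M[R]_3) :
  gram (row (inord 0) M) (row (inord 1) M) (row (inord 2) M) = \det M ^+ 2.
Proof.
pose f (p q : nat) := M (inord p) (inord q).
have Mf k l : M k l = f k l by rewrite /f !inord_val.
rewrite /gram !dotE !big_ord_recl !big_ord0 !mxE !Mf.
rewrite (expand_det_row _ ord0) !big_ord_recl big_ord0 /cofactor.
rewrite !(expand_det_row _ ord0) !big_ord_recl !big_ord0 /cofactor !det_mx11.
rewrite !mxE !Mf !inordK //=.
rewrite /bump /= ?add1n ?addn0 ?add0n.
ring.
Qed.
End Geometry.

(** * Tetrahedra with integral edges *)

Definition vtx k (lt_k4 : (k < 4)%N) : 'I_4 := Ordinal lt_k4.
Local Notation v0 := (@vtx 0 isT).
Local Notation v1 := (@vtx 1 isT).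
Local Notation v2 := (@vtx 2 isT).
Local Notation v3 := (@vtx 3 isT).

Definition edge (s : 'I_6) : 'I_4 * 'I_4 :=
  nth (v0, v0) [:: (v0, v1); (v0, v2); (v0, v3); (v1, v2); (v1, v3); (v2, v3)] s.

Definition opposite_edge (s : 'I_6) : 'I_4 * 'I_4 :=
  nth (v0, v0) [:: (v2, v3); (v1, v3); (v1, v2); (v0, v3); (v0, v2); (v0, v1)] s.

Lemma opposite_val (i j : 'I_4) :
  map val (opposite i j) =
    [seq m <- iota 0 4 | (m != val i) && (m != val j)].
Proof.
rewrite -val_enum_ord filter_map; by [].
Qed.

Lemma opposite_edgeE s :
  opposite (edge s).1 (edge s).2 = [:: (opposite_edge s).1; (opposite_edge s).2].
Proof.
apply: (inj_map val_inj); rewrite opposite_val.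
by case: s => [[|[|[|[|[|[|]]]]]] //=].
Qed.

Lemma edge_lt (s : 'I_6) : ((edge s).1 < (edge s).2)%N.
Proof. by case: s => [[|[|[|[|[|[|]]]]]] //=]. Qed.

Lemma edge_surj (i j : 'I_4) : (i < j)%N -> exists s, edge s = (i, j).
Proof.
move=> ij; suff s6 : (index (val i, val j)
    [:: (0, 1); (0, 2); (0, 3); (1, 2); (1, 3); (2, 3)] < 6)%N.
  exists (Ordinal s6); apply/eqP; move: s6.
  by case: i j ij => [[|[|[|[|]]]] //= ?] [[|[|[|[|]]]] //= ?].
by case: i j ij => [[|[|[|[|]]]] //= ?] [[|[|[|[|]]]] //= ?].
Qed.

Lemma sum_opposite_edge (h : 'I_4 -> nat) :
  (\sum_s (h (opposite_edge s).1 + h (opposite_edge s).2) = 3 * \sum_t h t)%N.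
Proof.
rewrite !big_ord_recl !big_ord0 /opposite_edge /=.
have e k (lt_k : (k < 4)%N) (t : 'I_4) : val t = k -> h t = h (vtx lt_k).
  by move=> tk; congr h; apply: val_inj.
rewrite !(e 0%N isT ord0) // (e 1%N isT (lift _ _)) //.
rewrite (e 2%N isT (lift _ (lift _ _))) // (e 3%N isT (lift _ (lift _ (lift _ _)))) //.
lia.
Qed.

Section IntegralTetrahedron.
Variables (R : realType) (v : 'I_4 -> 'rV[R]_3) (n : 'I_4 -> 'I_4 -> nat).
Hypothesis nE : forall i j, edge_length v i j = (n i j)%:R.

Let q i j : int := (n i j)%:Z ^+ 2.

Lemma sqr_edge i j : dot (v i - v j) (v i - v j) = (q i j)%:~R.
Proof. by rewrite -sqr_enorm -/(edge_length v i j) nE rmorphXn. Qed.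

Lemma sqr_edge_sym i j : q i j = q j i.
Proof.
apply: (@intr_inj R); rewrite -!sqr_edge.
by rewrite -opprB dotNl dotNr opprK.
Qed.

Definition face_heron i j k : int := heron (q i j) (q i k) (q j k).

(** Four times the inner product of the components of [v k - v i] and
    [v l - v i] orthogonal to the edge [ij], times the squared length of that
    edge. *)
Definition cosine_numerator i j k l : int :=
  2 * q i j * (q i k + q i l - q k l)
  - (q i j + q i k - q j k) * (q i j + q i l - q j l).

(** Four times the Gram determinant at the vertex [i], that is, 144 times the
    squared volume, as a polynomial in the squared edge lengths. *)
Definition gram4 i j k l : int :=
  4 * q i j * q i k * q i l
  + (q i j + q i k - q j k) * (q i j + q i l - q j l) * (q i k + q i l - q k l)
  - q i j * (q i k + q i l - q k l) ^+ 2
  - q i k * (q i j + q i l - q j l) ^+ 2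
  - q i l * (q i j + q i k - q j k) ^+ 2.

Lemma face_heronE i j k (e := v j - v i) (a := v k - v i) :
  4 * (dot e e * dot a a - dot a e ^+ 2) = (face_heron i j k)%:~R.
Proof.
rewrite /face_heron /heron; have qE := sqr_edge; clearbody q.
rewrite !(intrD, intrM, intrN, rmorphXn, mulr1z) -!qE.
rewrite [v j - v k](_ : _ = e - a); last by rewrite opprB addrA subrK.
rewrite -(opprB (v j)) -(opprB (v k)) -/e -/a; clearbody e a.
by rewrite !(dotBl, dotBr, dotNl, dotNr) (dotC e a); ring.
Qed.

Lemma cosine_numeratorE i j k l
    (e := v j - v i) (a := v k - v i) (b := v l - v i) :
  4 * (dot e e * dot a b - dot a e * dot b e) = (cosine_numerator i j k l)%:~R.
Proof.
rewrite /cosine_numerator; have qE := sqr_edge; clearbody q.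
rewrite !(intrD, intrM, intrN, rmorphXn, mulr1z) -!qE.
rewrite [v j - v k](_ : _ = e - a); last by rewrite opprB addrA subrK.
rewrite [v j - v l](_ : _ = e - b); last by rewrite opprB addrA subrK.
rewrite [v k - v l](_ : _ = a - b); last by rewrite opprB addrA subrK.
rewrite -(opprB (v j)) -(opprB (v k)) -(opprB (v l)) -/e -/a -/b; clearbody e a b.
rewrite !(dotBl, dotBr, dotNl, dotNr) (dotC e a) (dotC e b) (dotC b a); ring.
Qed.

Lemma gram4E i j k l (e := v j - v i) (a := v k - v i) (b := v l - v i) :
  gram e a b = (gram4 i j k l)%:~R / 4.
Proof.
rewrite /gram4; have qE := sqr_edge; clearbody q.
rewrite !(intrD, intrM, intrN, rmorphXn, mulr1z) -!qE.
rewrite [v j - v k](_ : _ = e - a); last by rewrite opprB addrA subrK.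
rewrite [v j - v l](_ : _ = e - b); last by rewrite opprB addrA subrK.
rewrite [v k - v l](_ : _ = a - b); last by rewrite opprB addrA subrK.
rewrite -(opprB (v j)) -(opprB (v k)) -(opprB (v l)) -/e -/a -/b; clearbody e a b.
rewrite /gram !(dotBl, dotBr, dotNl, dotNr).
rewrite (dotC e a) (dotC e b) (dotC b a).
by move: (dot _ _) (dot _ _) (dot _ _) (dot _ _) (dot _ _) (dot _ _) => *; field.
Qed.

(** The squared volume is symmetric in the vertices. *)
Lemma gram4_edge s :
  gram4 (edge s).1 (edge s).2 (opposite_edge s).1 (opposite_edge s).2 =
  gram4 v0 v1 v2 v3.
Proof.
have qC := sqr_edge_sym; rewrite /gram4; clearbody q.
case: s => [[|[|[|[|[|[|]]]]]] //= lt_s6]; rewrite /edge /opposite_edge /=.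
all: rewrite ?(qC v1 v0) ?(qC v2 v0) ?(qC v3 v0) ?(qC v2 v1) ?(qC v3 v1) ?(qC v3 v2).
all: move: (q v0 v1) (q v0 v2) (q v0 v3) (q v1 v2) (q v1 v3) (q v2 v3) => *.
all: ring.
Qed.

Definition heron_face (t : 'I_4) : nat :=
  `|nth 0 [:: face_heron v1 v2 v3; face_heron v0 v2 v3;
              face_heron v0 v1 v3; face_heron v0 v1 v2] t|.

Lemma heron_face_edge s :
  `|face_heron (edge s).1 (edge s).2 (opposite_edge s).1|%N
    = heron_face (opposite_edge s).2 /\
  `|face_heron (edge s).1 (edge s).2 (opposite_edge s).2|%N
    = heron_face (opposite_edge s).1.
Proof.
have qC := sqr_edge_sym; rewrite /heron_face /face_heron /heron; clearbody q.
case: s => [[|[|[|[|[|[|]]]]]] //= lt_s6]; rewrite /edge /opposite_edge /=.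
all: rewrite ?(qC v1 v0) ?(qC v2 v0) ?(qC v3 v0) ?(qC v2 v1) ?(qC v3 v1) ?(qC v3 v2).
all: move: (q v0 v1) (q v0 v2) (q v0 v3) (q v1 v2) (q v1 v3) (q v2 v3) => *.
all: by split; congr `|_|%N; ring.
Qed.

Hypothesis v_nondeg : nondegenerate_tetra v.

Lemma gram4_gt0 : (0 < gram4 v0 v1 v2 v3).
Proof.
move: v_nondeg; rewrite /nondegenerate_tetra; set M := \matrix_(i < 3) _.
rewrite row_free_unit unitmxE unitfE => detM.
have rowM k (lt_k : (k < 3)%N) (lt_k1 : (k.+1 < 4)%N) :
    row (inord k) M = v (vtx lt_k1) - v v0.
  rewrite rowK; congr (v _ - v _); apply: val_inj => //=.
  by rewrite inordK.
have := gram_det M; rewrite (rowM 0%N isT isT) (rowM 1%N isT isT) (rowM 2 isT isT) gram4E => GE.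
have : 0 < (gram4 v0 v1 v2 v3)%:~R / 4 :> R.
  by rewrite GE lt_def sqrf_eq0 detM sqr_ge0.
by rewrite pmulr_lgt0 ?invr_gt0 ?ltr0n // ltr0z.
Qed.

Definition six_volume : R := Num.sqrt ((gram4 v0 v1 v2 v3)%:~R / 4).

Lemma sqr_six_volume :
  six_volume ^+ 2 = ratr ((gram4 v0 v1 v2 v3)%:~R / 4).
Proof.
rewrite sqr_sqrtr ?fmorph_div /= ?ratr_int ?ratr_nat //.
by rewrite divr_ge0 // ler0z ltW // gram4_gt0.
Qed.

(** The face opposite to one end of the opposite edge contains the given edge
    and the other end, so [X] is the product of the terms of the two faces that
    meet along the edge. *)
Lemma dihedral_edge s (t := dihedral v (edge s).1 (edge s).2)
    (X := (heron_face (opposite_edge s).1 * heron_face (opposite_edge s).2)%N) :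
  [/\ (0 < X)%N, quadratic_angle six_volume (2 * t) &
      exists z : int, X%:R * (2 * cos (2 * t)) = z%:~R].
Proof.
pose i := (edge s).1; pose j := (edge s).2.
pose k := (opposite_edge s).1; pose l := (opposite_edge s).2.
have G_gt0 : 0 < gram (v j - v i) (v k - v i) (v l - v i).
  by rewrite gram4E gram4_edge divr_gt0 // ltr0z gram4_gt0.
have [A_gt0 B_gt0] := double_angle_orth_part G_gt0.
rewrite !face_heronE cosine_numeratorE gram4E gram4_edge -/six_volume.
rewrite -/(edge_length v j i) nE.
have -> : angle (orth_part (v j - v i) (v k - v i))
  (orth_part (v j - v i) (v l - v i)) = t by rewrite /t /dihedral opposite_edgeE.
have [hl hk] := heron_face_edge s.
move: A_gt0 B_gt0; rewrite !face_heronE !ltr0z => A_gt0 B_gt0.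
have Al : face_heron i j k = heron_face l by rewrite -hl gtz0_abs.
have Bk : face_heron i j l = heron_face k by rewrite -hk gtz0_abs.
rewrite Al Bk -!pmulrn; move: (cosine_numerator i j k l) => C cost sint.
have hk_gt0 : (0 < heron_face k)%N by rewrite -ltz_nat -Bk.
have hl_gt0 : (0 < heron_face l)%N by rewrite -ltz_nat -Al.
have hk0 : (heron_face k)%:R != 0 :> R by rewrite pnatr_eq0 -lt0n.
have hl0 : (heron_face l)%:R != 0 :> R by rewrite pnatr_eq0 -lt0n.
split; first by rewrite muln_gt0 hk_gt0.
  exists (2 * C%:~R ^+ 2 / ((heron_face l)%:R * (heron_face k)%:R) - 1).
  exists (8 * C%:~R * (n j i)%:R / ((heron_face l)%:R * (heron_face k)%:R)).
  rewrite cost sint rmorphB !fmorph_div !(rmorphXn, rmorphM) /= !ratr_nat !ratr_int.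
  by rewrite (ratr_nat R 1).
exists (4 * C ^+ 2 - 2 * (heron_face k * heron_face l)%N%:Z).
rewrite cost /X natrM -/k -/l rmorphB !(rmorphXn, rmorphM) /= -!pmulrn.
by field; rewrite hk0 hl0.
Qed.

Lemma heron_face_le N t : (forall i j, (n i j <= N)%N) ->
  (heron_face t <= 4 * N ^ 4)%N.
Proof.
move=> nN; have fh i j k : (`|face_heron i j k| <= 4 * N ^ 4)%N.
  have qN x y : 0 <= q x y <= N%:Z ^+ 2.
    by rewrite sqr_ge0 /q lerXn2r ?nnegrE // lez_nat.
  rewrite -lez_nat abszE (_ : (4 * N ^ 4)%N%:Z = 4 * (N%:Z ^+ 2) ^+ 2); last first.
    by rewrite -exprM -!natz natrM natrX.
  rewrite /face_heron /heron.
  move: (qN i j) (qN i k) (qN j k) => {qN}.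
  move: (q i j) (q i k) (q j k) (N%:Z ^+ 2) => a b c m.
  move=> /andP[a0 am] /andP[b0 bm] /andP[c0 cm].
  rewrite ler_norml -!mulrA; apply/andP; split; nia.
by case: t => [[|[|[|[|]]]] //= lt_t4]; rewrite /heron_face /=.
Qed.

End IntegralTetrahedron.

(** Powers of distinct primes are coprime. *)
Lemma prod_pfactor_dvd k (p : 'I_k -> nat) (X : nat) :
  injective p -> (forall i, prime (p i)) -> (\prod_i p i ^ logn (p i) X %| X)%N.
Proof.
move=> p_inj p_pr; rewrite -(big_map p predT (fun q => q ^ logn q X)%N) /=.
have : all prime (map p (index_enum 'I_k)) by apply/allP => _ /mapP[i _ ->].
have : uniq (map p (index_enum 'I_k)) by rewrite map_inj_uniq ?index_enum_uniq.
elim: (map p _) => [|q s IHs] /=; first by rewrite big_nil.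
move=> /andP[qs us] /andP[q_pr s_pr]; rewrite big_cons Gauss_dvd.
  by rewrite pfactor_dvdnn IHs.
apply: coprimeXl; rewrite big_seq; apply: (big_ind (coprime q)).
- exact: coprimen1.
- by move=> a b qa qb; rewrite coprimeMr qa.
- move=> x xs; apply: coprimeXr; rewrite prime_coprime // dvdn_prime2 ?(allP s_pr x xs) //.
  by apply: contraNneq qs => ->.
Qed.

Lemma sum_edges (V : nmodType) (F : 'I_4 -> 'I_4 -> V) :
  \sum_(i < 4) \sum_(j < 4 | (i < j)%N) F i j = \sum_s F (edge s).1 (edge s).2.
Proof.
pose f (p q : nat) := F (inord p) (inord q).
have Ff i j : F i j = f i j by rewrite /f !inord_val.
under eq_bigr do under eq_bigr do rewrite Ff.
under [RHS]eq_bigr do rewrite Ff.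
under eq_bigr do rewrite big_mkcond.
rewrite !big_ord_recl !big_ord0 /edge /= /bump /= !add0r !addr0 !addrA.
by [].
Qed.

(** * Scaling *)

Section Scaling.
Variable R : realType.
Implicit Types (v : 'I_4 -> 'rV[R]_3).

Lemma enormZ (k : R) x : 0 < k -> enorm (k *: x) = k * enorm x.
Proof.
move=> k0; rewrite /enorm dotZl dotZr mulrA sqrtrM ?mulr_ge0 ?(ltW k0) //.
by rewrite -expr2 sqrtr_sqr gtr0_norm.
Qed.

Lemma edge_lengthZ (k : R) v i j : 0 < k ->
  edge_length (fun t => k *: v t) i j = k * edge_length v i j.
Proof. by move=> k0; rewrite /edge_length -scalerBr enormZ. Qed.

Lemma dihedralZ (k : R) v i j : 0 < k ->
  dihedral (fun t => k *: v t) i j = dihedral v i j.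
Proof.
move=> k0; have kn0 := lt0r_neq0 k0.
have orthZ e x : orth_part (k *: e) (k *: x) = k *: orth_part e x.
  rewrite /orth_part scalerBr; congr (_ - _).
  rewrite !dotZl !dotZr !scalerA; congr (_ *: _).
  rewrite (mulrA k k (dot e e)) (mulrA k k (dot x e)).
  by rewrite -mulf_div divff ?mulf_neq0 // mul1r mulrC.
have angleZ x y : angle (k *: x) (k *: y) = angle x y.
  rewrite /angle !enormZ // dotZl dotZr; congr acos.
  by rewrite mulrACA mulrA -mulf_div divff ?mulf_neq0 // mul1r.
by rewrite /dihedral -!scalerBr !orthZ angleZ.
Qed.

Lemma nondegenerateZ (k : R) v : 0 < k ->
  nondegenerate_tetra v -> nondegenerate_tetra (fun t => k *: v t).
Proof.
rewrite /nondegenerate_tetra => k0.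
set M := \matrix_(i < 3) _; set M' := \matrix_(i < 3) _ => Mfree.
have -> : M' = k *: M by apply/row_matrixP => i; rewrite linearZ /= !rowK scalerBr.
by rewrite /row_free mxrank_scale_nz ?lt0r_neq0.
Qed.

Lemma edge_lengthC v i j : edge_length v i j = edge_length v j i.
Proof. by rewrite /edge_length /enorm -opprB dotNl dotNr opprK. Qed.

Lemma edge_length_gt0 v i j : nondegenerate_tetra v -> i != j ->
  0 < edge_length v i j.
Proof.
rewrite /nondegenerate_tetra; set M := \matrix_(i < 3) _ => /row_free_inj Minj.
have rowM k : row k M = v (lift ord0 k) - v ord0 by rewrite rowK.
have v_inj : injective v.
  have v0 k : v (lift ord0 k) != v ord0.
    apply/eqP => vk; have e : delta_mx 0 k *m M = (0 : 'rV_3) *m M.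
      by rewrite -rowE rowM vk subrr mul0mx.
    have /matrixP/(_ 0 k)/eqP := Minj 1%N _ _ e.
    by rewrite !mxE !eqxx oner_eq0.
  move=> x y; case: (unliftP ord0 x) => [x'|] ->; case: (unliftP ord0 y) => [y'|] ->.
  - move=> vxy; congr lift; apply/eqP.
    have e : (delta_mx 0 x' : 'rV_3) *m M = delta_mx 0 y' *m M.
      by rewrite -!rowE !rowM vxy.
    have /matrixP/(_ 0 x')/eqP := Minj 1%N _ _ e.
    by rewrite !mxE !eqxx /=; case: (x' == y'); rewrite ?oner_eq0.
  - by move/eqP; rewrite (negPf (v0 x')).
  - by move/esym/eqP; rewrite (negPf (v0 y')).
  - by [].
move=> ij; rewrite sqrtr_gt0 lt_def dot_ge0 andbT.
apply: contra ij; rewrite dotE psumr_eq0 => [/allP d0|k _]; last first.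
  by rewrite -expr2 sqr_ge0.
apply/eqP/v_inj/eqP; rewrite -subr_eq0; apply/eqP/rowP => k.
by have := d0 k; rewrite mem_index_enum -expr2 sqrf_eq0 => /(_ isT)/eqP->; rewrite mxE.
Qed.

End Scaling.

(** * Relations between dihedral angles *)

Definition edge_angle (R : realType) (v : 'I_4 -> 'rV[R]_3) (s : 'I_6) : R :=
  dihedral v (edge s).1 (edge s).2.

(** Proportionality to [n] is expressed by cross products, so that no
    denominators occur. *)
Definition relations_spanned_by (R : realType) k (t : 'I_k -> R)
    (n : 'I_k -> nat) : Prop :=
  forall x : 'I_k -> int,
    (exists q : rat, \sum_s (x s)%:~R * t s = ratr q * pi) <->
    (forall i j, x i * (n j)%:Z = x j * (n i)%:Z).

Lemma angle_class_relation (R : realType) k (t : 'I_k -> R) (x : 'I_k -> int) :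
  \sum_s (x s)%:~R *: angle_class (t s) = 0 :> lquot (@Qpi R) <->
  exists q : rat, \sum_s (x s)%:~R * t s = ratr q * pi.
Proof.
pose pr : ratvec R -> lquot (@Qpi R) := lproj (@Qpi R).
have pr0 : pr 0 = 0 by apply: (@addrI _ (pr 0)); rewrite -lprojD !addr0.
have -> : \sum_s (x s)%:~R *: angle_class (t s) =
    pr (\sum_s (x s)%:~R * t s : R).
  rewrite (big_morph pr (lprojD (@Qpi R)) pr0); apply: eq_bigr => s _.
  rewrite /angle_class -[_ *: lproj _ _]lprojZ; congr lproj.
  by rewrite -[_ *: _]/(ratr (x s)%:~R * t s) ratr_int.
rewrite -pr0; split=> [/lproj_eq|[q xq]]; first by rewrite subr0 => /asboolP.
by apply/lproj_eq; rewrite subr0; apply/asboolP; exists q.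
Qed.

(** Both the edge lengths and the relations lie on the left kernel of the
    matrix of [relation_matrix]. *)
Lemma edges_span_relations (R : realType) (v : 'I_4 -> 'rV[R]_3) :
    nondegenerate_tetra v -> dehn_invariant v = 0 ->
    has_dim (lspan (dihedral_classes v)) 5 ->
  exists (n : 'I_6 -> nat) (l : R),
    [/\ 0 < l, forall s, (0 < n s)%N,
        forall s, edge_length v (edge s).1 (edge s).2 = l * (n s)%:R &
        relations_spanned_by (edge_angle v) n].
Proof.
move=> v_nondeg dehn0 dim5; pose e s := edge_length v (edge s).1 (edge s).2.
pose a s : lquot (@Qpi R) := angle_class (edge_angle v s).
have classesE : dihedral_classes v = range a.
  apply/seteqP; split=> [_ [i [j [ij ->]]]|_ [s _ <-]].
    by have [s sE] := edge_surj ij; exists s; rewrite // /a /edge_angle sE.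
  by exists (edge s).1, (edge s).2; split=> //; apply: edge_lt.
have [A [fullA Arel Atens]] :=
  @relation_matrix rat (ratvec R) (lquot (@Qpi R)) _ _ a _ classesE dim5.
have eA j : \sum_s ratr (A s j) * e s = 0.
  by apply: (Atens e); rewrite -[RHS]dehn0 /dehn_invariant sum_edges.
have e_gt0 s : 0 < e s.
  by apply: edge_length_gt0 => //; rewrite neq_ltn edge_lt.
have [n [l [l_gt0 n_gt0 en nA]]] := positive_kernel_integral fullA e_gt0 eA.
exists n, l; split=> // x; rewrite -(angle_class_relation (edge_angle v) x).
pose xr : 'rV[rat]_6 := \row_s (x s)%:~R.
have xA : \sum_s (x s)%:~R *: angle_class (edge_angle v s) =
    0 :> lquot (@Qpi R) <-> xr *m A = 0.
  rewrite -Arel; split=> x0; rewrite -[RHS]x0.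
    by apply: eq_bigr => s _; rewrite mxE.
  by apply: eq_bigr => s _; rewrite mxE.
rewrite xA; split=> [x0 i j|xn].
  by apply: (@intr_inj rat); have := nA _ x0 i j; rewrite !mxE !intrM -!pmulrn.
have n0 : (n ord0)%:R != 0 :> R by rewrite pnatr_eq0 -lt0n.
apply/rowP => j; apply: (fmorph_inj (ratr : rat -> R)); rewrite !mxE rmorph0.
rewrite rmorph_sum /=; transitivity
  ((x ord0)%:~R / (n ord0)%:R / l * \sum_s ratr (A s j) * e s : R).
  2: by rewrite eA mulr0.
rewrite mulr_sumr; apply: eq_bigr => s _; rewrite rmorphM mxE /= ratr_int en.
have -> : (x s)%:~R = (x ord0)%:~R / (n ord0)%:R * (n s)%:R :> R.
  apply: (mulIf n0); rewrite mulrAC divfK // !pmulrn -!intrM.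
  by rewrite xn.
by field; rewrite n0 lt0r_neq0.
Qed.

(** [valuation_forms] is applied to the doubled dihedral angles. Only the
    primes up to the product [HH] of the four terms [heron_face] can have a
    nonzero form, so finitely many rows suffice; the row of an index that is not
    prime is set to 0, and is not selected since the resulting bound would
    force [M] to vanish. *)
Lemma bounded_proportional_vector (R : realType) (w : 'I_4 -> 'rV[R]_3)
    (n : 'I_4 -> 'I_4 -> nat) (N : nat) (m := fun s => n (edge s).1 (edge s).2) :
    nondegenerate_tetra w -> (forall i j, edge_length w i j = (n i j)%:R) ->
    (forall i j, (n i j <= N)%N) -> (forall s, (0 < m s)%N) ->
    relations_spanned_by (edge_angle w) m ->
  exists (p S : 'I_5 -> nat) (M : 'I_6 -> int),
    [/\ injective p, forall i, (1 < p i)%N &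
        (\prod_i p i ^ S i <= 256 * N ^ 16)%N] /\
    [/\ exists k, M k != 0, forall i j, M i * (m j)%:Z = M j * (m i)%:Z &
        forall k, (`|M k| <= 243 * \prod_i S i)%N].
Proof.
move=> w_nondeg nE nN m_gt0 rel.
pose H := heron_face n.
pose X s := (H (opposite_edge s).1 * H (opposite_edge s).2)%N.
have tq s : quadratic_angle (six_volume R n) (2 * edge_angle w s).
  by have [_ ? _] := dihedral_edge nE w_nondeg s.
have X_gt0 s : (0 < X s)%N by have [? _ _] := dihedral_edge nE w_nondeg s.
have Xz s : exists z : int, (X s)%:R * (2 * cos (2 * edge_angle w s)) = z%:~R.
  by have [_ _ ?] := dihedral_edge nE w_nondeg s.
have [r [r_le r_rel]] := valuation_forms (sqr_six_volume nE w_nondeg) tq.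
have relE (x : 'I_6 -> int) :
    (exists q : rat, \sum_s (x s)%:~R * (2 * edge_angle w s) = ratr q * pi) <->
    (forall i j, x i * (m j)%:Z = x j * (m i)%:Z).
  rewrite -rel.
  have -> : \sum_s (x s)%:~R * (2 * edge_angle w s) =
      2 * \sum_s (x s)%:~R * edge_angle w s.
    by rewrite mulr_sumr; apply: eq_bigr => s _; rewrite mulrCA.
  split=> -[q qE]; last by exists (2 * q); rewrite rmorphM /= ratr_nat -mulrA -qE.
  exists (q / 2); rewrite fmorph_div /= ratr_nat mulrAC -qE mulrAC.
  by rewrite divff ?mul1r // pnatr_eq0.
have H_gt0 t : (0 < H t)%N.
  have [s ts] : exists s, t = (opposite_edge s).1 \/ t = (opposite_edge s).2.
    case: t => [[|[|[|[|]]]] //= lt_t].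
    - by exists (@Ordinal 6 5 isT); left; apply: val_inj.
    - by exists (@Ordinal 6 1 isT); left; apply: val_inj.
    - by exists (@Ordinal 6 0 isT); left; apply: val_inj.
    - by exists (@Ordinal 6 0 isT); right; apply: val_inj.
  by have := X_gt0 s; rewrite /X muln_gt0 => /andP[]; case: ts => ->.
pose HH := (\prod_t H t)%N.
have HH_gt0 : (0 < HH)%N by apply: prodn_gt0.
have lognHH p : logn p HH = (\sum_t logn p (H t))%N.
  suff [] : (0 < HH)%N /\ logn p HH = (\sum_t logn p (H t))%N by [].
  apply: (big_ind2 (fun a b => (0 < a)%N /\ logn p a = b)).
  - by rewrite logn1.
  - by move=> a b c e [a0 <-] [c0 <-]; rewrite muln_gt0 a0 lognM.
  - by move=> t _.
have r_sum p : prime p -> (\sum_s `|r p s| <= 3 * logn p HH)%N.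
  move=> p_pr; rewrite lognHH -sum_opposite_edge; apply: leq_sum => s _.
  have [z zE] := Xz s; apply: leq_trans (r_le p s (X s) z p_pr _ zE) _.
    by rewrite -lt0n.
  by rewrite lognM.
pose B := HH.+1.
have r_big p : prime p -> (B <= p)%N -> forall s, r p s = 0.
  move=> p_pr Bp s; have := r_sum p p_pr; rewrite (ltn_log0 Bp) muln0.
  by rewrite leqn0 sum_nat_eq0 => /forallP/(_ s); rewrite absz_eq0 => /eqP.
pose r' (p : 'I_B) s : int := if prime p then r p s else 0.
have [|p0|x xr i j|g [M [g_inj M_neq0 M_prop M_le]]] :=
    @kernel_cofactor_bound 5 B r' m.
- exact: m_gt0.
- have [p_pr|npr] := boolP (prime p0); last first.
    by rewrite big1 // => s _; rewrite /r' (negPf npr) mulr0.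
  transitivity (\sum_s (m s)%:Z * r p0 s).
    by apply: eq_bigr => s _; rewrite /r' p_pr.
  apply: (r_rel (fun s => (m s)%:Z)).2 => //.
  by apply/relE => i j; rewrite mulrC.
- apply: (relE x).1; apply: (r_rel x).1 => p p_pr.
  have [ltp|lep] := ltnP p B; last by rewrite big1 // => s _; rewrite r_big ?mulr0.
  rewrite -[RHS](xr (Ordinal ltp)); apply: eq_bigr => s _.
  by rewrite /r' /= p_pr.
have g_pr i : prime (g i).
  have [k Mk] := M_neq0; apply: contraNT Mk => npr.
  rewrite -absz_eq0 -leqn0; apply: leq_trans (M_le k) _.
  have r0 : (\sum_s `|r' (g i) s| = 0)%N.
    by rewrite big1 // => s _; rewrite /r' (negPf npr).
  by rewrite (bigD1 i) //= r0 mul0n.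
exists (fun i => g i), (fun i => logn (g i) HH), M; split; split=> //.
- by move=> i j /val_inj/g_inj.
- by move=> i; apply: prime_gt1.
- apply: (@leq_trans HH).
    apply: dvdn_leq => //; apply: (prod_pfactor_dvd (p := fun i => g i)) => //.
    by move=> i j /val_inj/g_inj.
  apply: (@leq_trans (\prod_(t < 4) (4 * N ^ 4))%N).
    by apply: leq_prod => t _; apply: heron_face_le.
  rewrite prod_nat_const card_ord expnMn -expnM.
  by [].
- move=> k; apply: leq_trans (M_le k) _.
  have -> : 243%N = (\prod_(i < 5) 3)%N by rewrite prod_nat_const card_ord.
  rewrite -big_split /=; apply: leq_prod => i _.
  rewrite (leq_trans _ (r_sum _ (g_pr i))) //; apply: leq_sum => s _.
  by rewrite /r' g_pr.
Qed.

(** A nonzero integral vector [M] proportional to [n] becomes, up to sign, a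
    competitor for [n], so the minimality of the first entry of [n] gives the
    inequality for all entries. *)
Lemma minimal_edges (R : realType) (v : 'I_4 -> 'rV[R]_3) :
    nondegenerate_tetra v -> dehn_invariant v = 0 ->
    has_dim (lspan (dihedral_classes v)) 5 ->
  exists (n : 'I_6 -> nat) (l : R),
    [/\ 0 < l, forall s, (0 < n s)%N,
        forall s, edge_length v (edge s).1 (edge s).2 = l * (n s)%:R,
        relations_spanned_by (edge_angle v) n &
        forall M : 'I_6 -> int, (exists k, M k != 0) ->
          (forall i j, M i * (n j)%:Z = M j * (n i)%:Z) ->
          forall k, (n k <= `|M k|)%N].
Proof.
move=> v_nondeg dehn0 dim5.
have [n0 [l0 [l0_gt0 n0_gt0 en0 rel0]]] := edges_span_relations v_nondeg dehn0 dim5.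
pose P t := `[< exists (n : 'I_6 -> nat) (l : R), [/\ 0 < l, forall s, (0 < n s)%N,
  forall s, edge_length v (edge s).1 (edge s).2 = l * (n s)%:R & n ord0 = t] >].
have exP : exists t, P t by exists (n0 ord0); apply/asboolP; exists n0, l0.
have [t /asboolP[n [l [l_gt0 n_gt0 en nt]]] tmin] := ex_minnP exP.
have prop i j : (n i * n0 j = n j * n0 i)%N.
  apply/eqP; rewrite -(eqr_nat R) !natrM; apply/eqP.
  have ll0 : l * l0 != 0 by rewrite lt0r_neq0 // mulr_gt0.
  apply: (mulfI ll0); rewrite mulrACA -en -en0 mulrACA -en -en0.
  by rewrite mulrC.
have n0N i : (n0 i)%:Z != 0 by rewrite eqz_nat -lt0n.
have nN i : (n i)%:Z != 0 by rewrite eqz_nat -lt0n.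
exists n, l; split=> //.
  have transfer (a b : 'I_6 -> nat) (x : 'I_6 -> int) :
      (0 < a ord0)%N -> (forall i j, a i * b j = a j * b i)%N ->
      (forall i j, x i * (a j)%:Z = x j * (a i)%:Z) ->
      forall i j, x i * (b j)%:Z = x j * (b i)%:Z.
    move=> a_gt0 ab xa i j; have a0 : (a ord0)%:Z != 0 by rewrite eqz_nat -lt0n.
    apply: (mulIf a0); rewrite -!mulrA -!PoszM [(b j * _)%N]mulnC ab.
    rewrite [(b i * _)%N]mulnC [(a ord0 * _)%N]ab !PoszM !mulrA xa.
    by [].
  move=> x; rewrite (rel0 x); split; apply: transfer => // i j.
  by rewrite mulnC -prop mulnC.
move=> M [k0 Mk0] Mn.
have M_neq0 k : M k != 0.
  apply: contraNneq Mk0 => Mk; have := Mn k0 k; rewrite Mk mul0r.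
  by move/eqP; rewrite mulf_eq0 (negPf (nN _)) orbF.
have le0 : (n ord0 <= `|M ord0|)%N.
  rewrite nt; apply: tmin; apply/asboolP.
  exists (fun k => `|M k|%N), (l * (n ord0)%:R / `|M ord0|%N%:R); split=> //.
  - by rewrite divr_gt0 ?mulr_gt0 ?ltr0n ?absz_gt0.
  - by move=> s; rewrite absz_gt0.
  - move=> s; rewrite en -!mulrA; congr (l * _).
    have M0 : `|M ord0|%N%:R != 0 :> R by rewrite pnatr_eq0 absz_eq0.
    apply: (mulIf M0); rewrite mulrA mulrAC divfK //.
    rewrite -!natrM; congr _%:R.
    by have := congr1 absz (Mn ord0 s); rewrite !abszM /= mulnC => ->; rewrite mulnC.
move=> k; have := congr1 absz (Mn ord0 k); rewrite !abszM /= => Mk.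
rewrite -(leq_pmul2r (n_gt0 ord0)) -Mk mulnC.
by rewrite leq_pmul2r.
Qed.

Theorem theorem1p1 (R : realType) (v : 'I_4 -> 'rV[R]_3) :
  nondegenerate_tetra v ->
  dehn_invariant v = 0 ->
  has_dim (lspan (dihedral_classes v)) 5 ->
  exists w : 'I_4 -> 'rV[R]_3,
    [/\ nondegenerate_tetra w,
        similar_tetra v w &
        forall i j : 'I_4, (i < j)%N ->
          edge_length w i j \is a Num.int /\ edge_length w i j <= 3946 * 10 ^+ 9].
Proof.
move=> v_nondeg dehn0 dim5.
have [m [l [l_gt0 m_gt0 em rel m_min]]] := minimal_edges v_nondeg dehn0 dim5.
have li_gt0 : 0 < l^-1 by rewrite invr_gt0.
pose w t := l^-1 *: v t.
have w_nondeg : nondegenerate_tetra w by apply: nondegenerateZ.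
have we s : edge_length w (edge s).1 (edge s).2 = (m s)%:R.
  by rewrite edge_lengthZ // em mulKf // lt0r_neq0.
have wN i j : exists k : nat, edge_length w i j = k%:R.
  case: (ltngtP i j) => [ij|ji|/val_inj->].
  - by have [s sE] := edge_surj ij; exists (m s); rewrite -we sE.
  - by have [s sE] := edge_surj ji; exists (m s); rewrite edge_lengthC -we sE.
  - by exists 0%N; rewrite /edge_length subrr /enorm -(scale0r 0) dotZl mul0r sqrtr0.
have /choice[n nE] : forall ij : 'I_4 * 'I_4,
    exists k : nat, edge_length w ij.1 ij.2 = k%:R by move=> ij; apply: wN.
pose n4 i j := n (i, j); have n4E i j : edge_length w i j = (n4 i j)%:R by apply: nE (i, j).
have n4m s : n4 (edge s).1 (edge s).2 = m s.
  by apply/eqP; rewrite -(eqr_nat R) -n4E we.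
pose N := (\max_s m s)%N.
have n4N i j : (n4 i j <= N)%N.
  case: (ltngtP i j) => [ij|ji|/val_inj->].
  - by have [s sE] := edge_surj ij; rewrite (_ : n4 i j = m s) ?leq_bigmax // -n4m sE.
  - have [s sE] := edge_surj ji; rewrite (_ : n4 i j = m s) ?leq_bigmax //.
    by apply/eqP; rewrite -(eqr_nat R) -n4E edge_lengthC -we sE.
  - rewrite (_ : n4 j j = 0%N) //; apply/eqP; rewrite -(eqr_nat R) -n4E.
    by rewrite /edge_length subrr /enorm -(scale0r 0) dotZl mul0r sqrtr0.
have w_rel : relations_spanned_by (edge_angle w) (fun s => n4 (edge s).1 (edge s).2).
  move=> x; have -> : \sum_s (x s)%:~R * edge_angle w s = \sum_s (x s)%:~R * edge_angle v s.
    by apply: eq_bigr => s _; rewrite /edge_angle dihedralZ.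
  by rewrite (rel x); split=> xm i j; have := xm i j; rewrite !n4m.
have [|p [S [M [[p_inj p_gt1 pS] [M_neq0 M_prop M_le]]]]] :=
    bounded_proportional_vector w_nondeg n4E n4N _ w_rel.
  by move=> s; rewrite n4m.
have mM k : (m k <= `|M k|)%N.
  by apply: m_min => // i j; have := M_prop i j; rewrite !n4m.
have N_le : N%:R <= 3946 * 10 ^+ 9 :> R.
  apply: (@logarithmic_bound R p S N p_inj p_gt1 pS).
  by apply/bigmax_leqP => s _; apply: leq_trans (mM s) (M_le s).
exists w; split=> //.
  exists l^-1, (fun x => l^-1 *: x), 1%g; split=> //.
    by move=> x y; rewrite -scalerBr enormZ.
  by move=> i; rewrite perm1.
move=> i j _; rewrite n4E; split; first exact: natr_int.
by apply: le_trans N_le; rewrite ler_nat.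
Qed.
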